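(* Suppose that the friction conditions are imposed on the whole boundary $S$. If the boundary variational inequality: find $h_0=(h^{(1)}_0,h^{(2)}_0)^\top\in[H^{1/2}(S)]^6$ such that $$\langle\mathcal A^+h_0,h-h_0\rangle_S+j(h^{(1)})-j(h^{(1)}_0)\ge\langle\psi,h^{(1)}_n-h^{(1)}_{0n}\rangle_S+\langle\varphi,h^{(2)}-h^{(2)}_0\rangle_S\quad\text{for all }h=(h^{(1)},h^{(2)})^\top\in[H^{1/2}(S)]^6,$$ where $j(h^{(1)})=\int_S g\,|h^{(1)}_s-\varphi_0|\,dS$, has a solution, then $$\Big|\langle\psi,\vartheta_n\rangle_S+\langle\varphi,a\rangle_S\Big|\le\int_S g\,|\vartheta_s|\,dS\qquad\text{for all }\chi=(\vartheta,a)^\top\in\Lambda(S).$$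
   Context: **Geometry and material.** $\Omega^+\subset\mathbb R^3$ is a bounded domain with $C^\infty$-smooth simply connected boundary $S=\partial\Omega^+$, and $n$ is the unit normal on $S$ pointing outward from $\Omega^+$. $S$ is neither rotational (a surface of revolution) nor a ruled surface. $\partial_p=\partial/\partial x_p$; $\delta_{pq}$ is the Kronecker delta, $\varepsilon_{pqk}$ the Levi-Civita symbol. All functions are real-valued. The material constants $\alpha,\beta,\gamma,\delta,\lambda,\mu,\nu,\varkappa,\varepsilon\in\mathbb R$ satisfy $\mu>0$, $\alpha>0$, $\gamma>0$, $\varepsilon>0$, $3\lambda+2\mu>0$, $\mu\gamma-\varkappa^2>0$, $\alpha\varepsilon-\nu^2>0$, $(\mu+\alpha)(\gamma+\varepsilon)-(\varkappa+\nu)^2>0$, $(3\lambda+2\mu)(3\beta+2\gamma)-(3\delta+2\varkappa)^2>0$. For $U=(u,\omega)^\top$ with $u,\omega$ taking values in $\mathbb R^3$, put $u_{pq}=\partial_pu_q-\sum_k\varepsilon_{pqk}\omega_k$, $\omega_{pq}=\partial_p\omega_q$, and $\tau_{pq}(U)=(\mu+\alpha)\partial_pu_q+(\mu-\alpha)\partial_qu_p+\lambda\delta_{pq}\operatorname{div}u+\delta\,\delta_{pq}\operatorname{div}\omega+(\varkappa+\nu)\partial_p\omega_q+(\varkappa-\nu)\partial_q\omega_p-2\alpha\sum_k\varepsilon_{pqk}\omega_k$, $\mu_{pq}(U)=\delta\,\delta_{pq}\operatorname{div}u+(\varkappa+\nu)[\partial_pu_q-\sum_k\varepsilon_{pqk}\omega_k]+\beta\delta_{pq}\operatorname{div}\omega+(\varkappa-\nu)[\partial_qu_p-\sum_k\varepsilon_{qpk}\omega_k]+(\gamma+\varepsilon)\partial_p\omega_q+(\gamma-\varepsilon)\partial_q\omega_p$.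 The operator $L(\partial)$ is $L(\partial)U=(L_1U,L_2U)^\top$ with $(L_1U)_q=\sum_p\partial_p\tau_{pq}(U)$ and $(L_2U)_q=\sum_p\partial_p\mu_{pq}(U)+\sum_{l,r}\varepsilon_{qlr}\tau_{lr}(U)$. The energy form is $E(U,U')=\sum_{p,q}[\tau_{pq}(U)u'_{pq}+\mu_{pq}(U)\omega'_{pq}]$ (symmetric), and $B(U,U')=\int_{\Omega^+}E(U,U')\,dx$. For $X\in[L_2(\Omega^+)]^6$, $U\in[H^1(\Omega^+)]^6$ is a weak solution of $L(\partial)U+X=0$ in $\Omega^+$ if $B(U,\Phi)=\int_{\Omega^+}X\cdot\Phi\,dx$ for all $\Phi\in[C_0^\infty(\Omega^+)]^6$. **Traces.** $\{\cdot\}^+$ is the trace on $S$ from $\Omega^+$. The stress vector is $T(\partial,n)U=(\mathcal TU,\mathcal MU)^\top$, $(\mathcal TU)_q=\sum_p\tau_{pq}(U)n_p$, $(\mathcal MU)_q=\sum_p\mu_{pq}(U)n_p$; for $U\in[H^1(\Omega^+)]^6$ with $L(\partial)U\in[L_2(\Omega^+)]^6$ the generalized trace $\{T(\partial,n)U\}^+=(\{\mathcal TU\}^+,\{\mathcal MU\}^+)^\top\in[H^{-1/2}(S)]^6$ is defined by $\int_{\Omega^+}[L(\partial)U\cdot U'+E(U,U')]dx=\langle\{T(\partial,n)U\}^+,\{U'\}^+\rangle_S$ for all $U'\in[H^1(\Omega^+)]^6$. $\langle\cdot,\cdot\rangle_S$ is the duality between $H^{-1/2}(S)$ and $H^{1/2}(S)$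 (scalar and vector versions) extending the $L_2(S)$ inner product. For a vector field $F$ on $S$, $F_n=F\cdot n$ and $F_s=F-F_nn$; $\tau^{(n)}_n(U)=(\mathcal TU)_n$, $\tau^{(n)}_s(U)=(\mathcal TU)_s$. Elements of $[H^{1/2}(S)]^6$ are written $h=(h^{(1)},h^{(2)})^\top$ with two $3$-vector components. **Operators.** For $h\in[H^{1/2}(S)]^6$, $G^+h\in[H^1(\Omega^+)]^6$ is the unique weak solution of $L(\partial)U=0$ in $\Omega^+$ with $\{U\}^+=h$ (it is represented by a single layer potential). The Steklov–Poincaré operator is $\mathcal A^+h=\{T(\partial,n)(G^+h)\}^+\in[H^{-1/2}(S)]^6$. **Rigid displacements.** $\Lambda(S)$ is the set of restrictions to $S$ of the generalized rigid displacement vectors $\chi(x)=(\vartheta(x),a)^\top$, $\vartheta(x)=[a\times x]+b$, $a,b\in\mathbb R^3$. **Data.** $X\in[L_2(\Omega^+)]^6$, $F_0\in L_\infty(S)$, $\varphi\in[H^{-1/2}(S)]^3$, $\mathcal F:S\to[0,\infty)$ bounded measurable, $g=\mathcal F|F_0|$. $U_0=(u_0,\omega_0)^\top\in[H^1(\Omega^+)]^6$ is the unique weak solution of $L(\partial)U_0+X=0$ in $\Omega^+$ with $\{u_{0n}\}^+=0$, $\{\tau^{(n)}_s(U_0)\}^+=0$, $\{\mathcal MU_0\}^+=0$ on $S$; and $\psi=F_0-\{\tau^{(n)}_n(U_0)\}^+$, $\varphi_0=-\{u_{0s}\}^+$. *)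

(* Defs.v *)
(* Points of R^3 are nested pairs, so that the product
   topology, sigma-algebra and measure of the library apply to them; scalar
   fields are total functions on R^3, and fields "on S" or "on Omega" are total
   functions of which only the values on S, resp. Omega, matter. *)
From HB Require Import structures.
From mathcomp Require Export all_boot all_order all_algebra.
From mathcomp Require Export all_classical all_reals all_analysis.
Set Implicit Arguments.
Unset Strict Implicit.
Unset Printing Implicit Defensive.
Import Order.TTheory GRing.Theory Num.Theory.
Import numFieldNormedType.Exports.
Local Open Scope classical_set_scope.
Local Open Scope ring_scope.

Notation E3 R := (R * R * R)%type.

Section EuclideanSpace.
Variable R : realType.
Implicit Types (x y : E3 R) (a b : 'I_3 -> R).

Definition coord x (p : 'I_3) : R := [:: x.1.1; x.1.2; x.2]`_p.

Definition basis (p : 'I_3) : E3 R :=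
  ((p == 0)%:R, (p == 1)%:R, (p == 2%:R)%:R).

Definition dot a b : R := \sum_(p < 3) a p * b p.
Definition norm3 a : R := Num.sqrt (dot a a).
Definition dist3 x y : R := norm3 (coord (x - y)).

Definition kron (p q : 'I_3) : R := (p == q)%:R.

(* The indices 0, 1, 2 are added modulo 3. *)
Definition levi (p q k : 'I_3) : R :=
  if (q == p + 1) && (k == p + 2%:R) then 1
  else if (q == p + 2%:R) && (k == p + 1) then -1 else 0.

Definition cross a b (q : 'I_3) : R :=
  \sum_(k < 3) \sum_(l < 3) levi q k l * a k * b l.

Definition pd (p : 'I_3) (f : E3 R -> R) : E3 R -> R :=
  fun x => 'D_(basis p) f x.

Definition gradient (f : E3 R -> R) x : 'I_3 -> R := fun p => pd p f x.

Definition C1 (f : E3 R -> R) : Prop :=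
  continuous f /\
  forall p, (forall x, derivable f x (basis p)) /\ continuous (pd p f).

Definition smooth (f : E3 R -> R) : Prop :=
  forall s : seq 'I_3, C1 (foldr pd f s).

Definition test_fun (Om : set (E3 R)) (f : E3 R -> R) : Prop :=
  smooth f /\
  exists K, [/\ compact K, K `<=` Om & forall x, ~ K x -> f x = 0].

End EuclideanSpace.

Section Geometry.
Variable R : realType.
Implicit Types (A Om S : set (E3 R)) (x y : E3 R).

Definition bdry A : set (E3 R) := closure A `\` A°.

Definition bounded_domain Om : Prop :=
  [/\ open Om, connected Om, Om !=set0 & bounded_set Om].

Definition local_defining Om x (rho : E3 R -> R) : Prop :=
  [/\ smooth rho, norm3 (gradient rho x) != 0 &
      exists r : R, 0 < r /\
        forall y, dist3 x y < r -> (Om y <-> rho y < 0)].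

Definition smooth_bdry Om : Prop :=
  forall x, bdry Om x -> exists rho, local_defining Om x rho.

(* The vector given by any local defining function is the same. *)
Definition outward_unit_normal Om (n : 'I_3 -> E3 R -> R) : Prop :=
  forall x, bdry Om x -> forall rho, local_defining Om x rho ->
  forall p, n p x = gradient rho x p / norm3 (gradient rho x).

Definition path_connected A : Prop :=
  forall x y, A x -> A y -> exists c : R -> E3 R,
    [/\ {within `[0, 1], continuous c}, c 0 = x, c 1 = y &
        forall t : R, t \in `[0, 1] -> A (c t)].

Definition null_homotopic A (c : R -> E3 R) : Prop :=
  exists H : R * R -> E3 R,
    [/\ {within `[0, 1] `*` `[0, 1], continuous H},
        forall s t : R, s \in `[0, 1] -> t \in `[0, 1] -> A (H (s, t)),
        forall t : R, t \in `[0, 1] -> H (0, t) = c t,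
        forall t : R, t \in `[0, 1] -> H (1, t) = c 0 &
        forall s : R, s \in `[0, 1] -> H (s, 0) = c 0 /\ H (s, 1) = c 0].

Definition simply_connected A : Prop :=
  path_connected A /\
  forall c : R -> E3 R, {within `[0, 1], continuous c} -> c 0 = c 1 ->
    (forall t : R, t \in `[0, 1] -> A (c t)) -> null_homotopic A c.

(* There is an axis (through z, with direction d) such that, with each of its
   points, S contains the whole circle through it about the axis. *)
Definition surface_of_revolution S : Prop :=
  exists z d : E3 R, d != 0 /\
    forall x y, S x -> dist3 y z = dist3 x z ->
      dot (coord (y - z)) (coord d) = dot (coord (x - z)) (coord d) -> S y.

(* S is swept out by straight line segments. *)
Definition ruled_surface S : Prop :=
  forall x, S x -> exists d : E3 R, d != 0 /\
    forall t : R, t \in `[0, 1] -> S (x + t *: d).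

End Geometry.

Section SurfaceMeasure.
Variable R : realType.
Local Open Scope ereal_scope.

Definition diam3 (A : set (E3 R)) : \bar R :=
  ereal_sup ([set 0] `|` [set (dist3 x y)%:E | x in A & y in A]).

(* Every set is declared measurable, so that mu_ext below is an infimum over
   all countable covers. *)
Definition all_sets : Type := E3 R.
HB.instance Definition _ := Pointed.on all_sets.
HB.instance Definition _ := @isMeasurable.Build default_measure_display
  all_sets discrete_measurable discrete_measurable0
  discrete_measurableC discrete_measurableU.

Definition hgauge (delta : R) (A : set all_sets) : \bar R :=
  if diam3 A <= delta%:E then (pi / 4)%:E * (diam3 A * diam3 A) else +oo.

(* Two-dimensional Hausdorff (outer) measure, normalised so as to agree with
   the area on surfaces. *)
Definition hausdorff2 (A : set (E3 R)) : \bar R :=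
  ereal_sup [set mu_ext (hgauge delta) A | delta in [set d : R | (0 < d)%R]].

Lemma diam3_ge0 A : 0 <= diam3 A.
Proof. by apply: ereal_sup_ubound; left. Qed.

Lemma diam3_set0 : diam3 set0 = 0.
Proof.
rewrite /diam3; set B := [set _ | _ in _ & _ in _].
have -> : B = set0 by apply/seteqP; split => // z [x []].
by rewrite setU0 ereal_sup1.
Qed.

Lemma hgauge_ge0 delta A : 0 <= hgauge delta A.
Proof.
rewrite /hgauge; case: ifP => // _.
rewrite mule_ge0 ?mule_ge0 ?diam3_ge0// lee_fin.
by rewrite divr_ge0// pi_ge0.
Qed.

Lemma hgauge_set0 delta : (0 < delta)%R -> hgauge delta set0 = 0.
Proof. by move=> d0; rewrite /hgauge diam3_set0 lee_fin ltW// !mule0. Qed.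

Lemma mu_ext_hgauge_ge0 delta A : 0 <= mu_ext (hgauge delta) A.
Proof. by apply: mu_ext_ge0 => B; exact: hgauge_ge0. Qed.

Lemma hausdorff2_set0 : hausdorff2 set0 = 0.
Proof.
apply/eqP; rewrite eq_le; apply/andP; split.
  apply: ge_ereal_sup => _ [d d0 <-].
  by rewrite mu_ext0 //; [exact: hgauge_set0|exact: hgauge_ge0].
apply: (le_trans (mu_ext_hgauge_ge0 1 set0)).
by apply: ereal_sup_ubound; exists 1%R => //=.
Qed.

Lemma hausdorff2_ge0 A : 0 <= hausdorff2 A.
Proof.
apply: (le_trans (mu_ext_hgauge_ge0 1 A)).
by apply: ereal_sup_ubound; exists 1%R => //=.
Qed.

Lemma le_hausdorff2 : {homo hausdorff2 : A B / A `<=` B >-> A <= B}.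
Proof.
move=> A B AB; apply: ge_ereal_sup => _ [d d0 <-].
apply: (le_trans (le_mu_ext (hgauge d) AB)).
by apply: ereal_sup_ubound; exists d.
Qed.

Lemma hausdorff2_sigma_subadditive : sigma_subadditive hausdorff2.
Proof.
move=> F; apply: ge_ereal_sup => _ [d d0 <-].
have := @mu_ext_sigma_subadditive _ all_sets R (hgauge d) (hgauge_ge0 d)
  F.
move=> /le_trans; apply; apply: lee_nneseries => [i _ _|i _].
  exact: mu_ext_hgauge_ge0.
by apply: ereal_sup_ubound; exists d.
Qed.

HB.instance Definition _ := isOuterMeasure.Build R (E3 R) hausdorff2
  hausdorff2_set0 hausdorff2_ge0 le_hausdorff2 hausdorff2_sigma_subadditive.

Definition hausdorff2_outer : {outer_measure set (E3 R) -> \bar R} :=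
  hausdorff2.

(* The surface measure dS, on the sigma-algebra of Caratheodory-measurable
   sets of the Hausdorff measure. *)
Definition surface_space : Type := caratheodory_type hausdorff2_outer.
HB.instance Definition _ := Measurable.on surface_space.

Definition area : {measure set surface_space -> \bar R} :=
  hausdorff2_outer : set (caratheodory_type hausdorff2_outer) -> \bar R.

Definition leb3 : {measure set (E3 (measurableTypeR R)) -> \bar R} :=
  ((@lebesgue_measure R \x @lebesgue_measure R) \x @lebesgue_measure R).

End SurfaceMeasure.

Section FunctionSpaces.
Variable R : realType.
Implicit Types (Om S : set (E3 R)).

Definition L2 d (T : measurableType d) (m : {measure set T -> \bar R})
    (D : set T) (f : T -> R) : Prop :=
  measurable_fun D f /\ (\int[m]_(x in D) ((f x) ^+ 2)%:E < +oo)%E.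

Definition L2_dom Om (f : E3 R -> R) : Prop := L2 (leb3 R) Om f.
Definition L2_bdry S (f : E3 R -> R) : Prop := L2 (area R) S f.

Definition Linf_bdry S (f : E3 R -> R) : Prop :=
  measurable_fun (S : set (surface_space R)) f /\
  exists C : R, {ae area R, forall x, S x -> `|f x| <= C}.

Definition bounded_measurable_bdry S (f : E3 R -> R) : Prop :=
  measurable_fun (S : set (surface_space R)) f /\
  exists C : R, forall x, S x -> `|f x| <= C.

Definition int_dom Om (f : E3 R -> R) : R := \int[leb3 R]_(x in Om) f x.
Definition int_bdry S (f : E3 R -> R) : R := \int[area R]_(x in S) f x.

(* An element of H^1 is carried together with its weak gradient, which is
   determined almost everywhere by the function: wgrad u p is d_p u. *)
Record wfun := WFun {
  wval : E3 R -> R;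
  wgrad : 'I_3 -> E3 R -> R }.

Definition classical (f : E3 R -> R) : wfun := WFun f (fun p => pd p f).

Definition H1 Om (u : wfun) : Prop :=
  L2_dom Om (wval u) /\
  forall p, L2_dom Om (wgrad u p) /\
    forall f, test_fun Om f ->
      int_dom Om (fun x => wval u x * pd p f x) =
      - int_dom Om (fun x => wgrad u p x * f x).

(* The square of the norm of u - v in H^1. *)
Definition H1_sqdist Om (u v : wfun) : \bar R :=
  (\int[leb3 R]_(x in Om)
     ((wval u x - wval v x) ^+ 2
      + \sum_(p < 3) (wgrad u p x - wgrad v p x) ^+ 2)%R%:E)%E.

Definition H1_norm Om (u : wfun) : R :=
  Num.sqrt (fine (H1_sqdist Om u (classical (cst 0)))).

Definition L2_bdry_sqdist S (f g : E3 R -> R) : \bar R :=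
  (\int[area R]_(x in S) ((f x - g x) ^+ 2)%R%:E)%E.

(* The graph of the trace operator, i.e. of the continuous extension to
   H^1(Om) of the restriction to the boundary of C^1 functions. *)
Definition has_trace Om (u : wfun) (w : E3 R -> R) : Prop :=
  L2_bdry (bdry Om) w /\
  exists f : nat -> E3 R -> R,
    [/\ forall k, C1 (f k),
        H1_sqdist Om (classical (f k)) u @[k --> \oo] --> 0%E &
        L2_bdry_sqdist (bdry Om) (f k) w @[k --> \oo] --> 0%E].

(* H^{1/2}(S) as the trace space of H^1(Om), with the quotient norm; its dual
   is H^{-1/2}(S).  The bound in Hm12 is the boundedness of t for the quotient
   norm inf {|u|_{H^1} : u has trace w}; it makes t insensitive to
   modifications of w on null sets. *)
Definition H12 Om (w : E3 R -> R) : Prop := exists u, H1 Om u /\ has_trace Om u w.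

Definition functional : Type := (E3 R -> R) -> R.

Definition Hm12 Om (t : functional) : Prop :=
  (forall (c : R) w1 w2, H12 Om w1 -> H12 Om w2 ->
     t (fun x => c * w1 x + w2 x) = c * t w1 + t w2) /\
  exists C : R, forall u w, H1 Om u -> has_trace Om u w ->
    `|t w| <= C * H1_norm Om u.

(* Three-vector fields are given by components; pairs of those are the
   six-vector fields (u, omega). *)
Definition vfield : Type := 'I_3 -> E3 R -> R.
Definition vfield6 : Type := (vfield * vfield)%type.
Definition wfield6 : Type := (('I_3 -> wfun) * ('I_3 -> wfun))%type.
Definition functional3 : Type := 'I_3 -> functional.
Definition functional6 : Type := (functional3 * functional3)%type.

Definition classical6 (F : vfield6) : wfield6 :=
  (fun q => classical (F.1 q), fun q => classical (F.2 q)).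
Definition wval6 (U : wfield6) : vfield6 :=
  (fun q => wval (U.1 q), fun q => wval (U.2 q)).

Definition zero6 : vfield6 := (fun _ => cst 0, fun _ => cst 0).
Definition opp6 (F : vfield6) : vfield6 :=
  (fun q x => - F.1 q x, fun q x => - F.2 q x).
Definition sub6 (F G : vfield6) : vfield6 :=
  (fun q x => F.1 q x - G.1 q x, fun q x => F.2 q x - G.2 q x).
Definition dot6 (F G : vfield6) (x : E3 R) : R :=
  \sum_(q < 3) (F.1 q x * G.1 q x + F.2 q x * G.2 q x).

Definition L2_6 Om (F : vfield6) : Prop :=
  forall q, L2_dom Om (F.1 q) /\ L2_dom Om (F.2 q).
Definition H1_6 Om (U : wfield6) : Prop :=
  forall q, H1 Om (U.1 q) /\ H1 Om (U.2 q).
Definition H12_6 Om (h : vfield6) : Prop :=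
  forall q, H12 Om (h.1 q) /\ H12 Om (h.2 q).
Definition has_trace6 Om (U : wfield6) (h : vfield6) : Prop :=
  forall q, has_trace Om (U.1 q) (h.1 q) /\ has_trace Om (U.2 q) (h.2 q).
Definition test_field6 Om (F : vfield6) : Prop :=
  forall q, test_fun Om (F.1 q) /\ test_fun Om (F.2 q).

Definition Hm12_3 Om (t : functional3) : Prop := forall q, Hm12 Om (t q).
Definition Hm12_6 Om (t : functional6) : Prop :=
  Hm12_3 Om t.1 /\ Hm12_3 Om t.2.

Definition pair3 (t : functional3) (F : vfield) : R := \sum_(q < 3) t q (F q).
Definition pair6 (t : functional6) (h : vfield6) : R :=
  pair3 t.1 h.1 + pair3 t.2 h.2.

(* Normal and tangential parts with respect to a unit normal field n, of
   fields and (by transposition) of functionals. *)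
Definition nrm (n F : vfield) (x : E3 R) : R := \sum_(q < 3) F q x * n q x.
Definition tang (n F : vfield) : vfield :=
  fun q x => F q x - nrm n F x * n q x.
Definition nrm_fun (n : vfield) (t : functional3) : functional :=
  fun f => \sum_(q < 3) t q (fun x => n q x * f x).
Definition tang_fun (n : vfield) (t : functional3) : functional3 :=
  fun q f => t q f - nrm_fun n t (fun x => n q x * f x).

Definition length (F : vfield) (x : E3 R) : R := norm3 (fun q => F q x).

End FunctionSpaces.

Section Elasticity.
Variable R : realType.

Record material := Material {
  c_alpha : R; c_beta : R; c_gamma : R; c_delta : R; c_lambda : R;
  c_mu : R; c_nu : R; c_kappa : R; c_eps : R }.

Definition admissible (m : material) : Prop :=
  let: Material al be ga de la mu nu ka ep := m in
  (0 < mu) /\ (0 < al) /\ (0 < ga) /\ (0 < ep) /\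
  (0 < 3 * la + 2 * mu) /\ (0 < mu * ga - ka ^+ 2) /\
  (0 < al * ep - nu ^+ 2) /\
  (0 < (mu + al) * (ga + ep) - (ka + nu) ^+ 2) /\
  (0 < (3 * la + 2 * mu) * (3 * be + 2 * ga) - (3 * de + 2 * ka) ^+ 2).

Implicit Types (U V : wfield6 R) (x : E3 R) (p q : 'I_3) (Om : set (E3 R)).

Definition wdiv (u : 'I_3 -> wfun R) x : R := \sum_(k < 3) wgrad (u k) k x.

(* d_p u_q - sum_k eps_pqk omega_k *)
Definition strain U p q x : R :=
  wgrad (U.1 q) p x - \sum_(k < 3) levi R p q k * wval (U.2 k) x.

Definition tau (m : material) U p q x : R :=
  let: Material al be ga de la mu nu ka ep := m in
  (mu + al) * wgrad (U.1 q) p x + (mu - al) * wgrad (U.1 p) q x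
  + la * kron R p q * wdiv U.1 x + de * kron R p q * wdiv U.2 x
  + (ka + nu) * wgrad (U.2 q) p x + (ka - nu) * wgrad (U.2 p) q x
  - 2 * al * \sum_(k < 3) levi R p q k * wval (U.2 k) x.

Definition cstress (m : material) U p q x : R :=
  let: Material al be ga de la mu nu ka ep := m in
  de * kron R p q * wdiv U.1 x + (ka + nu) * strain U p q x
  + be * kron R p q * wdiv U.2 x + (ka - nu) * strain U q p x
  + (ga + ep) * wgrad (U.2 q) p x + (ga - ep) * wgrad (U.2 p) q x.

Definition energy (m : material) U V x : R :=
  \sum_(p < 3) \sum_(q < 3)
    (tau m U p q x * strain V p q x + cstress m U p q x * wgrad (V.2 q) p x).

Definition Bform (m : material) Om U V : R :=
  int_dom Om (energy m U V).

Definition weak_solution (m : material) Om (X : vfield6 R) U : Prop :=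
  H1_6 Om U /\
  forall F, test_field6 Om F ->
    Bform m Om U (classical6 F) = int_dom Om (dot6 X F).

(* The identity L(d)U = F in the sense of distributions on Om. *)
Definition L_eq (m : material) Om U (F : vfield6 R) : Prop :=
  forall f, test_fun Om f -> forall q,
    - int_dom Om (fun x => \sum_(p < 3) tau m U p q x * pd p f x)
      = int_dom Om (fun x => F.1 q x * f x) /\
    int_dom Om (fun x =>
      - (\sum_(p < 3) cstress m U p q x * pd p f x)
      + (\sum_(l < 3) \sum_(r < 3) levi R q l r * tau m U l r x) * f x)
      = int_dom Om (fun x => F.2 q x * f x).

(* t is the generalized trace {T(d,n)U}^+, where L(d)U = F belongs to L_2. *)
Definition stress_trace (m : material) Om U (F : vfield6 R)
    (t : functional6 R) : Prop :=
  [/\ L2_6 Om F, L_eq m Om U F, Hm12_6 Om t &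
      forall V h, H1_6 Om V -> has_trace6 Om V h ->
        int_dom Om (fun x => dot6 F (wval6 V) x + energy m U V x) = pair6 t h].

(* The operator G^+ of the Dirichlet problem. *)
Definition dirichlet_operator (m : material) Om
    (G : vfield6 R -> wfield6 R) : Prop :=
  forall h, H12_6 Om h ->
    weak_solution m Om (zero6 R) (G h) /\ has_trace6 Om (G h) h.

(* A h = {T(d,n)(G h)}^+, where L(d)(G h) = 0. *)
Definition steklov_poincare (m : material) Om (G : vfield6 R -> wfield6 R)
    (A : vfield6 R -> functional6 R) : Prop :=
  forall h, H12_6 Om h -> stress_trace m Om (G h) (zero6 R) (A h).

(* U0 solves the auxiliary problem L(d)U0 + X = 0 in Om, {u_0n}^+ = 0,
   {tau_s(U0)}^+ = 0, {M U0}^+ = 0; w0 = {u_0}^+ and t0 = {T(d,n)U0}^+. *)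
Definition auxiliary_solution (m : material) Om (n : vfield R)
    (X : vfield6 R) (U0 : wfield6 R) (w0 : vfield R)
    (t0 : functional6 R) : Prop :=
  [/\ weak_solution m Om X U0,
      forall q, has_trace Om (U0.1 q) (w0 q),
      stress_trace m Om U0 (opp6 X) t0,
      {ae area R, forall x, bdry Om x -> nrm n w0 x = 0} &
      forall q f, H12 Om f -> tang_fun n t0.1 q f = 0 /\ t0.2 q f = 0].

(* psi = F0 - {tau_n(U0)}^+ and phi0 = - {u_0s}^+ *)
Definition psi_data Om (n : vfield R) (F0 : E3 R -> R)
    (t0 : functional6 R) : functional R :=
  fun f => int_bdry (bdry Om) (fun x => F0 x * f x) - nrm_fun n t0.1 f.

Definition phi0_data (n w0 : vfield R) : vfield R := fun q x => - tang n w0 q x.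

Definition friction_functional Om (n : vfield R) (g : E3 R -> R)
    (phi0 h1 : vfield R) : R :=
  int_bdry (bdry Om)
    (fun x => g x * length (fun q y => tang n h1 q y - phi0 q y) x).

(* The generalized rigid displacement ([a x x] + b, a). *)
Definition rigid (a b : 'I_3 -> R) : vfield6 R :=
  (fun q x => cross a (coord x) q + b q, fun q => cst (a q)).

End Elasticity.

(* Main.v *)
(* Testing the inequality with h = h0 + chi, chi a rigid displacement, gives
   the claim without absolute value: <A h0, chi> is the integral of
   E(G h0, chi), which vanishes because the strains of chi do, and
   j(h0 + chi) - j(h0) <= int g |chi_s| by the triangle inequality.  Replacing
   chi by - chi gives the other sign.

   With the surface measure defined as a Hausdorff measure, chi is an admissible
   test function only once continuous functions are known to be square
   integrable on S.  Borel sets are measurable since the Hausdorff measure is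
   additive on sets at positive distance; and the area of S is finite since S is
   compact and locally a Lipschitz graph, by the mean value theorem applied to a
   defining function.

   The functional psi is only linear on H^{1/2}(S), so replacing chi by - chi
   also requires n_q chi_n to be in H^{1/2}(S): the normal field is extended to
   a C^1 field on R^3, and C^1 functions are in H^1 (integration by parts, from
   Fubini's theorem) and have their restriction as trace. *)
Require Import Defs.
From HB Require Import structures.
From mathcomp Require Import measurable_realfun ring lra zify.
Import Order.TTheory GRing.Theory Num.Theory.
Import numFieldNormedType.Exports.
Set Implicit Arguments.
Unset Strict Implicit.
Unset Printing Implicit Defensive.
Local Open Scope classical_set_scope.
Local Open Scope ring_scope.

(** Real-valued integrals can be added and compared only for integrable integrands, so every factor
    is placed in L^2 of S: h0 and the trace of U0 lie there by the definition of a trace, chi and n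
    because they are bounded and measurable on a set of finite area, and g as a bounded multiple of
    F0. The vector h0 + chi must moreover be a trace again, and traces are defined by approximation:
    the approximating sequences are added, and (a + b)^2 <= 2 a^2 + 2 b^2 controls both distances.
    The strains of chi vanish because the gradient of the rotation a x x is exactly the skew matrix
    that the microrotation a subtracts; this is the cyclic symmetry of the Levi-Civita symbol. The
    class C^1 is the natural one for the extended normal, since the approximants in the definition
    of a trace are C^1 functions on the whole space. *)

Section Coordinates.
Variable R : realType.
Implicit Types (x y : E3 R) (p q : 'I_3).

Lemma forall_I3 (P : 'I_3 -> Prop) : P 0 -> P 1 -> P 2%:R -> forall p, P p.
Proof.
move=> P0 P1 P2 [[|[|[|//]]] i].
- by rewrite (_ : Ordinal i = 0) //; exact: val_inj.
- by rewrite (_ : Ordinal i = 1) //; exact: val_inj.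
- by rewrite (_ : Ordinal i = 2%:R) //; exact: val_inj.
Qed.

Lemma sum_I3 (F : 'I_3 -> R) : \sum_(p < 3) F p = F 0 + F 1 + F 2%:R.
Proof.
rewrite !big_ord_recr big_ord0 /= add0r; congr (F _ + F _ + F _);
  exact: val_inj.
Qed.

Lemma coord_inj x y : (forall p, coord x p = coord y p) -> x = y.
Proof.
case: x y => [[x0 x1] x2] [[y0 y1] y2] H.
by have := H 0; have := H 1; have := H 2%:R; rewrite /coord /= => -> -> ->.
Qed.

Lemma coordD x y p : coord (x + y) p = coord x p + coord y p.
Proof. by move: p; apply: forall_I3. Qed.

Lemma coordB x y p : coord (x - y) p = coord x p - coord y p.
Proof. by move: p; apply: forall_I3. Qed.

Lemma coordZ (a : R) x p : coord (a *: x) p = a * coord x p.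
Proof. by move: p; apply: forall_I3. Qed.

Lemma coord_basis p q : coord (basis R p) q = kron R p q.
Proof.
rewrite /kron; move: p q.
by apply: forall_I3; apply: forall_I3.
Qed.

Lemma norm3_ge0 (a : 'I_3 -> R) : 0 <= norm3 a.
Proof. exact: sqrtr_ge0. Qed.

Lemma dot_ge0 (a : 'I_3 -> R) : 0 <= dot a a.
Proof. by apply: sumr_ge0 => p _; rewrite -expr2 sqr_ge0. Qed.

Lemma sqr_norm3 (a : 'I_3 -> R) : norm3 a ^+ 2 = dot a a.
Proof. by rewrite sqr_sqrtr// dot_ge0. Qed.

Lemma ler_norm3 (a : 'I_3 -> R) p : `|a p| <= norm3 a.
Proof.
rewrite -sqrtr_sqr ler_wsqrtr// /dot (bigD1 p)//= expr2 lerDl.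
by apply: sumr_ge0 => q _; rewrite -expr2 sqr_ge0.
Qed.

(** The factor 2 is a convenient bound for the square root of 3. *)
Lemma norm3_le (a : 'I_3 -> R) (c : R) : (forall p, `|a p| <= c) ->
  norm3 a <= 2 * c.
Proof.
move=> ac; have c0 : 0 <= c by apply: le_trans (ac 0).
rewrite -(@ler_pXn2r _ 2)// ?nnegrE ?norm3_ge0 ?mulr_ge0//.
rewrite sqr_norm3 /dot sum_I3.
have H p : a p * a p <= c ^+ 2.
  by rewrite -expr2 -real_normK ?num_real// ler_pXn2r ?nnegrE.
by have := H 0; have := H 1; have := H 2%:R; have := sqr_ge0 c; nra.
Qed.

Lemma coord_dist3 x y p : `|coord x p - coord y p| <= dist3 x y.
Proof. by rewrite -coordB; exact: ler_norm3. Qed.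

End Coordinates.

(** * Measurability for the Hausdorff measure *)

Section HausdorffMetric.
Variable R : realType.
Local Open Scope ereal_scope.
Implicit Types (A X Y : set (E3 R)) (d s t : R) (p : 'I_3).

Lemma le_diam3 A B : A `<=` B -> diam3 A <= diam3 B.
Proof.
move=> AB; apply: ereal_sup_le => z /= [->|]; first by left.
by move=> [x Ax [y Ay <-]]; right; exists x; [exact: AB|exists y; [exact: AB|]].
Qed.

Lemma le_hgauge d A B : A `<=` B -> hgauge d A <= hgauge d B.
Proof.
move=> AB; rewrite /hgauge; have dAB := le_diam3 AB.
case: ifPn => [dA|ndA]; last first.
  by rewrite ifF//; apply/negP => dB; move/negP: ndA; apply; exact: le_trans dB.
case: ifP => dB; last by rewrite leey.
apply: lee_wpmul2l; first by rewrite lee_fin divr_ge0// pi_ge0.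
by apply: lee_pmul => //; exact: diam3_ge0.
Qed.

Lemma hgauge_antitone d d' A : (d <= d')%R -> hgauge d' A <= hgauge d A.
Proof.
move=> dd'; rewrite /hgauge; case: ifPn => [dA|ndA].
  by case: ifP => // _; rewrite leey.
rewrite ifF//; apply/negP => dB; move/negP: ndA; apply.
by apply: le_trans dB _; rewrite lee_fin.
Qed.

(** Sets larger than the scale cost +oo, so a smaller scale only makes covers dearer. The supremum
    in [hausdorff2] is thus a limit as the scale tends to 0, and scales may be shrunk at will. *)
Lemma mu_ext_hgauge_antitone d d' A : (d <= d')%R ->
  mu_ext (hgauge d') A <= mu_ext (hgauge d) A.
Proof.
move=> dd'; apply: le_ereal_inf_tmp => _ [F cF <-].
apply: (@le_trans _ _ (\sum_(k <oo) hgauge d' (F k))).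
  by apply: ereal_inf_lbound; exists F.
apply: lee_nneseries => [*|k _]; first exact: hgauge_ge0.
exact: hgauge_antitone.
Qed.

Definition below p s : set (E3 R) := [set x | (coord x p <= s)%R].
Definition above p s : set (E3 R) := [set x | (s <= coord x p)%R].

(** A set of diameter at most d cannot meet both half-spaces when the gap between them exceeds d, so
    one of the two terms is zero; a set of larger diameter has gauge +oo. *)
Lemma hgauge_separated d p s t A : (0 < d)%R -> (d < t - s)%R ->
  hgauge d (A `&` below p s) + hgauge d (A `&` above p t) <= hgauge d A.
Proof.
move=> d0 dst; rewrite {3}/hgauge; case: ifPn => [dA|]; last by rewrite leey.
have [[x [Ax xs]]|nA] := pselect ((A `&` below p s) !=set0); last first.
  have -> : A `&` below p s = set0.
    by apply/seteqP; split => // x Hx; apply: nA; exists x.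
  rewrite hgauge_set0// add0e.
  by apply: le_trans (le_hgauge d (@subIsetl _ A _)) _; rewrite /hgauge dA.
have -> : A `&` above p t = set0.
  apply/seteqP; split => // y [Ay ty].
  have : (dist3 y x <= d)%R.
    rewrite -lee_fin; apply: le_trans dA; apply: ereal_sup_ubound.
    by right; exists y => //; exists x.
  move=> /(le_trans (coord_dist3 y x p)) /(le_trans (ler_norm _)).
  by move: xs ty; rewrite /below /above /=; lra.
rewrite hgauge_set0// adde0.
by apply: le_trans (le_hgauge d (@subIsetl _ A _)) _; rewrite /hgauge dA.
Qed.

Lemma mu_ext_hgauge_separated d p s t A : (0 < d)%R -> (d < t - s)%R ->
  mu_ext (hgauge d) (A `&` below p s) + mu_ext (hgauge d) (A `&` above p t)
  <= mu_ext (hgauge d) A.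
Proof.
move=> d0 dst; apply: le_ereal_inf_tmp => _ [F [mF cF] <-].
apply: (@le_trans _ _ (\sum_(k <oo) hgauge d (F k `&` below p s) +
                       \sum_(k <oo) hgauge d (F k `&` above p t))).
  apply: leeD; apply: ereal_inf_lbound.
  - exists (fun k => F k `&` below p s) => //; split=> //.
    by rewrite -setI_bigcupl; exact: setSI.
  - exists (fun k => F k `&` above p t) => //; split=> //.
    by rewrite -setI_bigcupl; exact: setSI.
rewrite -nneseriesD//; try by move=> *; exact: hgauge_ge0.
apply: lee_nneseries => [k _ _|k _]; last exact: hgauge_separated.
by apply: adde_ge0; exact: hgauge_ge0.
Qed.

Lemma hausdorff2_separated p s t A : (s < t)%R ->
  hausdorff2 (A `&` below p s) + hausdorff2 (A `&` above p t) <= hausdorff2 A.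
Proof.
move=> st.
have le_H B d : (0 < d)%R -> mu_ext (hgauge d) B <= hausdorff2 B.
  by move=> d0; apply: ereal_sup_ubound; exists d.
have [->|Afin] := eqVneq (hausdorff2 A) +oo; first by rewrite leey.
have fA : hausdorff2 A \is a fin_num.
  by rewrite ge0_fin_numE ?ltey// hausdorff2_ge0.
have fAB B : hausdorff2 (A `&` B) \is a fin_num.
  rewrite ge0_fin_numE ?hausdorff2_ge0//.
  by apply: le_lt_trans (le_hausdorff2 (@subIsetl _ A B)) _; rewrite ltey.
rewrite -leeBrDr//; apply: ge_ereal_sup => _ [d d0 <-].
rewrite leeBrDr// addeC -leeBrDr; last first.
  rewrite ge0_fin_numE ?mu_ext_hgauge_ge0//.
  by apply: le_lt_trans (le_H _ _ d0) _; rewrite -ge0_fin_numE ?hausdorff2_ge0.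
apply: ge_ereal_sup => _ [d' d'0 <-].
rewrite leeBrDr; last first.
  rewrite ge0_fin_numE ?mu_ext_hgauge_ge0//.
  by apply: le_lt_trans (le_H _ _ d0) _; rewrite -ge0_fin_numE ?hausdorff2_ge0.
(* The two measures on the left are approximated at unrelated scales d and d'. The scale e is below
   both, and below the gap, so that covers at scale e separate the two parts. *)
pose e := Num.min (Num.min d d') ((t - s) / 2)%R.
have e0 : (0 < e)%R.
  by rewrite !lt_min; move: d0 d'0 => /= -> ->; rewrite /= divr_gt0// subr_gt0.
apply: le_trans (le_H A e e0).
apply: le_trans (@mu_ext_hgauge_separated e p s t A e0 _); last first.
  have : (e <= (t - s) / 2)%R by rewrite ge_min lexx orbT.
  by move: st; lra.
rewrite addeC; apply: leeD; apply: mu_ext_hgauge_antitone.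
- by rewrite !ge_min lexx.
- by rewrite !ge_min lexx !orbT.
Qed.
End HausdorffMetric.

Section Caratheodory.
Variable R : realType.
Local Open Scope ereal_scope.
Local Notation H := (@hausdorff2 R).
Implicit Types (A : set (E3 R)) (p : 'I_3) (c : R).

(** Carathéodory's argument for metric outer measures, for a half-space: its complement is exhausted
    by sets at positive distance from it, and the error is the tail of a convergent series of thin
    shells. *)
Lemma hausdorff2_split A p c : H A < +oo ->
  H (A `&` below p c) + H (A `&` ~` below p c) <= H A.
Proof.
move=> Afin; pose t (k : nat) : R := (c + k.+1%:R^-1)%R.
have tS k : (t k.+1 < t k)%R by rewrite ltrD2l ltf_pV2 ?posrE// ltr_nat.
pose D k := A `&` [set x | (t k < coord x p)%R].
(* The shells around level [c]; shell [k.+2] lies at positive distance from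
   shell [k], so their measures are summable. *)
pose B k := A `&` [set x | (t k.+2 < coord x p <= t k.+1)%R].
have HD k : H (D k) <= H A by apply: le_hausdorff2; exact: subIsetl.
(* Shell k lies below level t (k + 1) and [D k] above level t k, and both are contained in
   [D k.+2]. *)
have step k : H (B k) + H (D k) <= H (D k.+2).
  apply: le_trans (hausdorff2_separated p (D k.+2) (tS k)).
  apply: leeD; apply: le_hausdorff2 => x [Ax /=].
    by move=> /andP[? ?]; split.
  move=> xk; split; last exact: ltW.
  by split => //=; rewrite (lt_trans (tS _))// (lt_trans (tS _)).
(* [step] advances the index by two, so the even and the odd shells telescope separately; this is
   why two consecutive sets D appear on the right. *)
have sumB n : \sum_(0 <= k < n) H (B k) <= H (D n.+1) + H (D n).
  elim: n => [|n IH].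
    by rewrite big_geq// adde_ge0// hausdorff2_ge0.
  rewrite big_nat_recr//= [leRHS]addeC.
  apply: le_trans (leeD2r _ IH) _; rewrite -addeA leeD2l//.
  by rewrite addeC.
have serB : \sum_(0 <= k <oo) H (B k) < +oo.
  apply: (@le_lt_trans _ _ (H A + H A)); last by rewrite lte_add_pinfty.
  apply: lime_le.
    by apply: is_cvg_nneseries => n _ _; exact: hausdorff2_ge0.
  by apply: nearW => n; apply: le_trans (sumB n) _; exact: leeD.
have tail0 := nneseries_tail_cvg serB (fun k _ => hausdorff2_ge0 (B k)).
have key N : H (A `&` below p c) + H (A `&` ~` below p c) <=
    H A + \sum_(N <= k <oo) H (B k).
  have ct : (c < t N.+1)%R by rewrite ltrDl invr_gt0.
  apply: le_trans (leeD2r _ (hausdorff2_separated p A ct)).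
  rewrite -addeA leeD2l//.
  have /le_trans := outer_measure_sigma_subadditive_tail (@hausdorff2_outer R) N B.
  move=> /(_ _ (lexx _)) => le_tail.
  apply: le_trans (leeD2l _ le_tail).
  apply: (@le_trans _ _ (H ((A `&` above p (t N.+1)) `|`
       \bigcup_(n in ~` `I_N) B n))); last first.
    exact: (outer_measureU2 (@hausdorff2_outer R)).
  apply: le_hausdorff2 => x [Ax]; rewrite /below /= => /negP; rewrite -ltNge => cx.
  have [xN|xN] := leP (t N.+1) (coord x p); [by left|right].
  have [m0 Hm0] : exists m, (t m < coord x p)%R.
    have [m Hm] := ltr_add_invr cx; exists m; exact: Hm.
  (* For the least m with t m < x_p one has t m < x_p <= t (m - 1), so x lies in shell m - 2; since
     m > N + 1, this index is at least N. *)
  have ex : exists m, (t m < coord x p)%R by exists m0.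
  case: (ex_minnP ex) => m tm minm.
  have tmono k l : (k <= l)%N -> (t l <= t k)%R.
    by move=> kl; rewrite lerD2l lef_pV2 ?posrE// ler_nat.
  have Nm : (N.+1 < m)%N.
    rewrite ltnNge; apply/negP => mN.
    by have := tmono _ _ mN; move: xN tm; clear; lra.
  case: m => [//|[//|k]] in tm minm Nm *; exists k => /=.
    by apply/negP; rewrite -leqNgt -ltnS -ltnS.
  split=> //=; rewrite tm /= leNgt; apply/negP => /minm.
  by rewrite ltnn.
rewrite -[leRHS]adde0.
have cv : H A + \sum_(N <= k <oo) H (B k) @[N --> \oo] --> H A + 0.
  apply: cvgeD; [|exact: cvg_cst|exact: tail0].
  by rewrite fin_num_adde_defl.
by apply: (cvge_ge _ cv); exact: nearW.
Qed.

Lemma caratheodory_below p c : (@hausdorff2_outer R).-caratheodory (below p c).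
Proof.
apply: le_caratheodory_measurable => A.
have [->|Afin] := eqVneq (hausdorff2_outer R A) +oo; first by rewrite leey.
by apply: hausdorff2_split; rewrite ltey.
Qed.

End Caratheodory.

(** * Borel sets and continuous functions, for Lebesgue and for surface measure *)

Section Borel.
Variable R : realType.
Implicit Types (x y : E3 R) (p q : 'I_3).

Lemma ball_coordP x (e : R) y :
  ball x e y <-> forall p, `|coord x p - coord y p| < e.
Proof.
split=> [[[H0 H1] H2]|H]; first by apply: forall_I3.
by split; [split|]; [exact: (H 0)|exact: (H 1)|exact: (H 2%:R)].
Qed.

Lemma nbhs_coordP x (U : set (E3 R)) :
  nbhs x U <-> exists2 e : R, 0 < e &
    forall y, (forall p, `|coord x p - coord y p| < e) -> U y.
Proof.
split=> [/(@nbhs_ballP R)[e e0 H]|[e e0 H]]; last apply/(@nbhs_ballP R).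
  by exists e => // y /ball_coordP; exact: H.
by exists e => // y /ball_coordP; exact: H.
Qed.

Lemma continuous_coord p : continuous (fun x => coord x p).
Proof.
move=> x; apply/cvgrPdist_lt => e e0; apply: (proj2 (nbhs_coordP x _)).
by exists e => // y; apply.
Qed.

Definition rat_box (b : (rat * rat) * (rat * rat) * (rat * rat)) : set (E3 R) :=
  [set x | [/\ ratr b.1.1.1 < coord x 0 < ratr b.1.1.2,
    ratr b.1.2.1 < coord x 1 < ratr b.1.2.2 &
    ratr b.2.1 < coord x 2%:R < ratr b.2.2]].

(** Second countability in the form used below: boxes with rational corners form a countable family,
    and their preimages only involve coordinates. *)
Lemma open_bigcup_rat_box (U : set (E3 R)) : open U ->
  U = \bigcup_(b in [set b | rat_box b `<=` U]) rat_box b.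
Proof.
move=> oU; apply/seteqP; split=> [x Ux|x [b bU /bU//]].
have /nbhs_coordP[e e0 eU] : nbhs x U by exact: open_nbhs_nbhs.
have rat_near (c : R) : exists ab : rat * rat, [/\ c - e < ratr ab.1,
    ratr ab.1 < c, c < ratr ab.2 & ratr ab.2 < c + e].
  have [|a /andP[a1 a2]] := @rat_in_itvoo R (c - e) c; first lra.
  have [|b /andP[b1 b2]] := @rat_in_itvoo R c (c + e); first lra.
  by exists (a, b).
have [b0 [b01 b02 b03 b04]] := rat_near (coord x 0).
have [b1 [b11 b12 b13 b14]] := rat_near (coord x 1).
have [b2 [b21 b22 b23 b24]] := rat_near (coord x 2%:R).
exists (b0, b1, b2) => /=; last by split=> /=; apply/andP.
move=> y [/= /andP[y01 y02] /andP[y11 y12] /andP[y21 y22]].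
apply: eU; apply: forall_I3; rewrite ltr_norml; apply/andP; split; lra.
Qed.

Section MeasurableCoordinates.
Context d (T : measurableType d) (f : T -> E3 R).
Hypothesis mf : forall p, measurable_fun setT (fun t => coord (f t) p).

(** Stated for a map f with measurable coordinates, so that one argument serves the product
    sigma-algebra, the Carathéodory sigma-algebra and the planar sections used with Fubini's
    theorem. *)
Lemma measurable_preimage_open (U : set (E3 R)) : open U ->
  measurable (f @^-1` U).
Proof.
move=> /open_bigcup_rat_box ->; rewrite preimage_bigcup bigcup_mkcond.
apply: countable_bigcupT_measurable => [|b]; first exact: countableP.
case: ifPn => // _.
have -> : f @^-1` rat_box b =
    (fun t => coord (f t) 0) @^-1` `]ratr b.1.1.1, ratr b.1.1.2[ `&`
    (fun t => coord (f t) 1) @^-1` `]ratr b.1.2.1, ratr b.1.2.2[ `&`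
    (fun t => coord (f t) 2%:R) @^-1` `]ratr b.2.1, ratr b.2.2[.
  apply/seteqP; split => t /=; rewrite !in_itv /=.
    by case.
  by case=> -[].
have m p a c : measurable ((fun t => coord (f t) p) @^-1` `]a, c[).
  rewrite -[X in measurable X]setTI; apply: mf => //.
by apply: measurableI => //; exact: measurableI.
Qed.

Lemma measurable_fun_continuous_comp (g : E3 R -> R) : continuous g ->
  measurable_fun setT (g \o f).
Proof.
move=> cg; apply: (measurability _ (measurable_realfun.RGenOpens.measurableE R)).
move=> _ [_ [a [b ->] <-]]; rewrite setTI.
apply: (@measurable_preimage_open (g @^-1` `]a, b[)).
by move/continuousP : cg; apply; exact: interval_open.
Qed.

End MeasurableCoordinates.

Lemma measurable_coord_leb p :
  measurable_fun setT (fun x : E3 (measurableTypeR R) => coord x p : R).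
Proof.
move: p; apply: forall_I3 => /=.
- exact: (measurableT_comp measurable_fst measurable_fst).
- exact: (measurableT_comp measurable_snd measurable_fst).
- exact: measurable_snd.
Qed.

Lemma measurable_coord_area p :
  measurable_fun setT (fun x : surface_space R => coord x p : R).
Proof.
apply: (measurability _ (measurable_realfun.RGenInftyO.measurableE R)).
move=> _ [_ [a ->] <-]; rewrite setTI.
(* Measurability is available for the closed half-spaces [below]; an open one is a countable union
   of these. *)
have -> : (fun x : surface_space R => coord x p : R) @^-1` `]-oo, a[ =
    \bigcup_k below p (a - k.+1%:R^-1).
  apply/seteqP; split => x /=; rewrite /below in_itv /=.
    move=> xa; have [k Hk] := ltr_add_invr xa; exists k => //=.
    by rewrite lerBrDr ltW.
  by move=> [k _ /=] /le_lt_trans; apply; rewrite ltrBlDr ltrDl invr_gt0.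
apply: bigcupT_measurable => k; exact: caratheodory_below.
Qed.

Lemma open_measurable_leb (U : set (E3 R)) : open U ->
  measurable (U : set (E3 (measurableTypeR R))).
Proof. exact: (@measurable_preimage_open _ _ id measurable_coord_leb). Qed.

Lemma open_measurable_area (U : set (E3 R)) : open U ->
  measurable (U : set (surface_space R)).
Proof.
exact: (@measurable_preimage_open _ (surface_space R) (fun x => x)
  measurable_coord_area).
Qed.

Lemma closed_measurable_area (K : set (E3 R)) : closed K ->
  measurable (K : set (surface_space R)).
Proof.
move=> cK; rewrite -(setCK K); apply: measurableC; apply: open_measurable_area.
exact: closed_openC.
Qed.

Lemma continuous_measurable_leb (g : E3 R -> R) : continuous g ->
  measurable_fun setT (g : E3 (measurableTypeR R) -> R).
Proof.
exact: (@measurable_fun_continuous_comp _ _ id measurable_coord_leb).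
Qed.

Lemma continuous_measurable_area (g : E3 R -> R) : continuous g ->
  measurable_fun setT (g : surface_space R -> R).
Proof.
exact: (@measurable_fun_continuous_comp _ (surface_space R) (fun x => x)
  measurable_coord_area).
Qed.

End Borel.

(** * Finiteness of the area of a compact smooth surface *)

Section Boxes.
Variable R : realType.
Implicit Types (x y z : E3 R) (A K Om : set (E3 R)) (p q : 'I_3).

Definition cube (M : R) : set (E3 R) := [set x | forall p, `|coord x p| <= M].

Definition square (M : R) : set (R * R) := `[- M, M] `*` `[- M, M].

Lemma cubeE (M : R) : cube M = square M `*` `[- M, M].
Proof.
apply/seteqP; split=> [x cx|x [[/= x0 x1] x2]].
  by split; [split|] => /=; rewrite in_itv /= -ler_norml;
    [exact: (cx 0)|exact: (cx 1)|exact: (cx 2%:R)].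
by move: x0 x1 x2; rewrite !in_itv => x0 x1 x2;
  apply: forall_I3; rewrite ler_norml.
Qed.

Lemma cube_compact (M : R) : compact (cube M).
Proof.
rewrite cubeE; apply: compact_setX; last exact: segment_compact.
by apply: compact_setX; exact: segment_compact.
Qed.

Lemma cube_closed (M : R) : closed (cube M).
Proof.
exact: (@compact_closed _ _ (@norm_hausdorff R (E3 R)) (@cube_compact M)).
Qed.

Lemma bounded_set_cube A : bounded_set A -> exists2 M, 0 < M & A `<=` cube M.
Proof.
move=> /pinfty_ex_gt0[M M0 AM]; exists M => // x /AM /= xM p.
apply: le_trans xM; move: p; apply: forall_I3.
- by rewrite /= /Num.norm /= !le_max lexx.
- by rewrite /= /Num.norm /= !le_max lexx ?orbT.
- by rewrite /= /Num.norm /= !le_max lexx ?orbT.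
Qed.

Lemma bdry_closed A : closed (bdry A).
Proof.
rewrite /bdry setDE; apply: closedI; first exact: closed_closure.
exact/open_closedC/open_interior.
Qed.

Lemma bdry_compact A : bounded_set A -> compact (bdry A).
Proof.
move=> /bounded_set_cube[M M0 AM].
apply: (@subclosed_compact _ _ (cube M) (@bdry_closed A) (@cube_compact M)).
apply: subset_trans (@subDsetl _ _ _) _.
by rewrite closureE; apply: smallest_sub => //; exact: cube_closed.
Qed.

Definition ocube x (e : R) : set (E3 R) :=
  [set y | forall p, `|coord x p - coord y p| < e].

Lemma ocubexx x (e : R) : 0 < e -> ocube x e x.
Proof. by move=> e0 p; rewrite subrr normr0. Qed.

Lemma ocube_open x (e : R) : open (ocube x e).
Proof.
have -> : ocube x e = ball x e.
  by apply/seteqP; split=> y; rewrite ball_coordP.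
exact: (@ball_open R (E3 R)).
Qed.

(** The subcover comes as a list: the area bound is an induction over it, and the normal field is
    extended by a sum over it. *)
Lemma compact_finite_cover K (B : E3 R -> set (E3 R)) : compact K ->
  (forall x, K x -> open (B x) /\ B x x) ->
  exists2 s : seq (E3 R), (forall x, x \in s -> K x) &
    forall y, K y -> exists2 x, x \in s & B x y.
Proof.
move=> + BK; rewrite (@compact_cover (E3 R : pseudoMetricNormedZmodType R)) => cK.
have [||D DK KD] := cK _ K B.
- by move=> x /BK[].
- by move=> x Kx; exists x => //; have [] := BK x Kx.
exists (finmap.enum_fset D) => [x xD|y Ky].
  by have := DK x xD; rewrite inE.
by have [x xD Bxy] := KD y Ky; exists x.
Qed.

End Boxes.

(** * Finite area of a piece whose points depend in a Lipschitz way on two coordinates *)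

Section LipschitzPiece.
Variable R : realType.
Implicit Types (x y z : E3 R) (K : set (E3 R)) (p q : 'I_3).

Lemma other_coords p q : q = p \/ q = p + 1 \/ q = p + 2%:R.
Proof.
move: p q; apply: forall_I3; apply: forall_I3;
  first [by left; exact: val_inj | by right; left; exact: val_inj
  | by right; right; exact: val_inj].
Qed.

Lemma near_of_same_floor (h u v : R) (k : nat) : 0 < h ->
  k%:R <= u / h < k.+1%:R -> k%:R <= v / h < k.+1%:R -> `|u - v| <= h.
Proof.
move=> h0; rewrite !ler_pdivlMr// !ltr_pdivrMr// -natr1.
by rewrite mulrDl mul1r ler_norml => /andP[? ?] /andP[? ?]; apply/andP; lra.
Qed.

Lemma add1_neq p : (p + 1 != p) && (p + 2%:R != p).
Proof. by move: p; apply: forall_I3. Qed.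

(* The square of side [2 e] around the projection of [a] is cut into [N ^ 2]
   squares; the piece of [K] over each of them has diameter [O(e / N)]. *)
Lemma hausdorff2_Lipschitz_piece K (a : E3 R) p (e L : R) : 0 < e -> 0 <= L ->
  K `<=` ocube a e ->
  (forall y z s, K y -> K z ->
    (forall q, q != p -> `|coord y q - coord z q| <= s) -> dist3 y z <= L * s) ->
  (hausdorff2 K < +oo)%E.
Proof.
move=> e0 L0 Ka KL.
(* There are N^2 cells of diameter at most L (2 e / N) each, so N cancels and the bound is the same
   at every scale d. *)
apply: (@le_lt_trans _ _ (pi / 4 * (L * (2 * e)) ^+ 2)%:E); last exact: ltry.
apply: ge_ereal_sup => _ [d /= d0 <-].
(* N is taken so large that every cell has diameter at most d, which keeps its gauge finite. *)
have [N N0 Nd] : exists2 N : nat, (0 < N)%N & L * (2 * e / N%:R) <= d.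
  pose x := L * (2 * e) / d.
  have x0 : 0 <= x by rewrite !mulr_ge0// ?invr_ge0 ltW.
  exists (Num.truncn x).+1 => //; rewrite mulrA ler_pdivrMr ?ltr0n//.
  by have := truncnS_gt x; rewrite {1}/x ltr_pdivrMr// mulrC => /ltW;
    rewrite mulrC [leRHS]mulrC.
pose h := 2 * e / N%:R.
have h0 : 0 < h by rewrite !mulr_gt0// invr_gt0 ltr0n.
pose idx q y := Num.truncn ((coord y q - coord a q + e) / h).
have arg_ge0 q y : K y -> 0 <= (coord y q - coord a q + e) / h.
  move=> /Ka /(_ q); rewrite ltr_norml => /andP[_ ye].
  by rewrite divr_ge0 ?(ltW h0)//; lra.
have idx_lt q y : K y -> (idx q y < N)%N.
  move=> Ky; rewrite /idx truncn_lt_nat ?arg_ge0// ltr_pdivrMr//.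
  rewrite /h mulrCA divff ?pnatr_eq0 -?lt0n// mulr1.
  by have := Ka _ Ky q; rewrite ltr_norml => /andP[? _]; lra.
have idx_near q y z : K y -> K z -> idx q y = idx q z ->
    `|coord y q - coord z q| <= h.
  move=> Ky Kz yz.
  have := truncn_itv (arg_ge0 q y Ky); have := truncn_itv (arg_ge0 q z Kz).
  rewrite -/(idx q y) -/(idx q z) yz => zi yi.
  have := near_of_same_floor h0 yi zi.
  by rewrite opprD addrACA subrr addr0 opprB addrA subrK.
(* The number k encodes the pair of square indices as quotient and remainder modulo N. Indices of
   coordinates add modulo 3, so p + 1 and p + 2 are the two coordinates other than p. *)
pose cell (k : nat) : set (E3 R) := K `&` [set y | idx (p + 1) y = (k %/ N)%N /\
  idx (p + 2%:R) y = (k %% N)%N].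
pose F (k : nat) := if (k < N ^ 2)%N then cell k else set0.
have diamF k : (diam3 (F k) <= (L * h)%:E)%E.
  apply: ge_ereal_sup => _ [->|[y Fy [z Fz <-]]].
    by rewrite lee_fin mulr_ge0// ltW.
  move: Fy Fz; rewrite /F; case: ifP => // _ [Ky /= [y1 y2]] [Kz /= [z1 z2]].
  rewrite lee_fin; apply: KL => // q; have [->|[->|->]] := other_coords p q.
  - by rewrite eqxx.
  - by move=> _; apply: idx_near => //; rewrite y1 z1.
  - by move=> _; apply: idx_near => //; rewrite y2 z2.
have gaugeF k : (hgauge d (F k) <= (pi / 4 * (L * h) ^+ 2)%:E)%E.
  rewrite /hgauge ifT; last by apply: le_trans (diamF k) _; rewrite lee_fin.
  rewrite (EFinM (pi / 4)) expr2 (EFinM (L * h)); apply: lee_pmul => //.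
  - by rewrite lee_fin divr_ge0// pi_ge0.
  - by rewrite mule_ge0// diam3_ge0.
  - by apply: lee_pmul => //; exact: diam3_ge0.
apply: (@le_trans _ _ (\sum_(k <oo) hgauge d (F k))%E).
  apply: ereal_inf_lbound; exists F => //; split=> // y Ky.
  exists (idx (p + 1)%R y * N + idx (p + 2%:R)%R y)%N => //=.
  have i1 := idx_lt (p + 1) _ Ky; have i2 := idx_lt (p + 2%:R) _ Ky.
  rewrite /F ifT; last by move: i1 i2; rewrite expnS expn1; nia.
  split=> //=; rewrite divnMDl// divn_small// addn0 modnMDl modn_small//.
rewrite (@nneseries_split _ _ 0 (N ^ 2)); last first.
  by move=> *; exact: hgauge_ge0.
rewrite (_ : (\sum_(0 + N ^ 2 <= k <oo) hgauge d (F k) = 0)%E); last first.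
  apply: eseries0 => k Nk _; rewrite /F ltnNge Nk /=; exact: hgauge_set0.
rewrite adde0 add0n.
apply: (@le_trans _ _ (\sum_(0 <= k < N ^ 2) (pi / 4 * (L * h) ^+ 2)%:E)%E).
  by apply: lee_sum => k _; exact: gaugeF.
rewrite sumEFin lee_fin sumr_const_nat subn0 -[leLHS]mulr_natr natrX.
have N0' : N%:R != 0 :> R by rewrite pnatr_eq0 -lt0n.
by rewrite le_eqVlt; apply/orP; left; apply/eqP; rewrite /h; field.
Qed.

End LipschitzPiece.

(** * Smooth boundaries as local Lipschitz graphs *)

Section LocalGraph.
Variable R : realType.
Implicit Types (x y z : E3 R) (Om : set (E3 R)) (p q : 'I_3) (f rho : E3 R -> R).

(** Passage from directional derivatives to functions of one variable, to which the mean value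
    theorem and the fundamental theorem of calculus apply. *)
Lemma is_derive_line f x (v : E3 R) (t : R) : derivable f (x + t *: v) v ->
  is_derive t 1 (fun s => f (x + s *: v)) ('D_v f (x + t *: v)).
Proof.
move=> df; have E : (fun h => h^-1 *: (((fun s : R => f (x + s *: v)) \o shift t)
     (h *: 1) - f (x + t *: v))) =
    (fun h => h^-1 *: ((f \o shift (x + t *: v)) (h *: v) - f (x + t *: v))).
  apply/funext => h /=; congr (_ *: (f _ - _)).
  by rewrite /shift /= [_%:A]mulr1 scalerDl addrCA addrA.
apply: DeriveDef; first by rewrite /derivable E.
by rewrite /derive E.
Qed.

Lemma ocube_segment x (e : R) y q (h t : R) : ocube x e y ->
  ocube x e (y + h *: basis R q) -> 0 <= t <= 1 ->
  ocube x e (y + (t * h) *: basis R q).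
Proof.
move=> yx zx /andP[t0 t1] p; have := zx p; have := yx p.
rewrite !coordD !coordZ !coord_basis !ltr_norml /kron.
move: t0 t1; case: eqP => _; rewrite ?mulr1 ?mulr0 ?addr0 //.
move=> t0 t1 /andP[? ?] /andP[? ?]; have [h0|h0] := leP 0 h.
  have th0 : 0 <= t * h by rewrite mulr_ge0.
  have thh : t * h <= h by rewrite ler_piMl.
  by apply/andP; split; lra.
have th0 : t * h <= 0 by rewrite mulr_ge0_le0// ltW.
have thh : h <= t * h by rewrite ler_niMl// ltW.
by apply/andP; split; lra.
Qed.

Lemma mvt_coord f x (e : R) y q (h : R) :
  (forall z, derivable f z (basis R q)) ->
  ocube x e y -> ocube x e (y + h *: basis R q) ->
  exists2 xi, ocube x e xi & f (y + h *: basis R q) - f y = pd q f xi * h.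
Proof.
move=> df yx zx; pose g (t : R) := f (y + t *: (h *: basis R q)).
have dg (t : R) : is_derive t 1 g (h * pd q f (y + (t * h) *: basis R q)).
  have -> : g = (fun s => f (y + s *: basis R q)) \o (fun s => h *: s).
    by apply/funext => s; rewrite /g /= scalerA mulrC.
  apply: is_derive_eq.
    by apply: is_derive1_comp; apply: is_derive_line; exact: df.
  by rewrite /pd [_%:A]mulr1 mulrC [h *: t]mulrC.
have cg : continuous g.
  move=> t; apply/differentiable_continuous/derivable1_diffP.
  by have [] := dg t.
have [t] := @MVT_segment R g _ 0 1 ler01 (fun t _ => dg t)
  (continuous_subspaceT cg).
rewrite in_itv /= => t01; rewrite /g scale1r scale0r addr0 subr0 mulr1 => ->.
exists (y + (t * h) *: basis R q); last by rewrite mulrC.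
exact: ocube_segment.
Qed.

(** The path from y to z runs along three segments parallel to the axes, whose vertices take each
    coordinate from y or from z and so stay in the cube. Each segment has its own intermediate
    point, hence a family xi. *)
Lemma mean_value f x (e : R) y z :
  (forall q u, derivable f u (basis R q)) -> ocube x e y -> ocube x e z ->
  exists2 xi, (forall q, ocube x e (xi q)) &
    f z - f y = \sum_(q < 3) pd q f (xi q) * (coord z q - coord y q).
Proof.
move=> df xy xz; pose w1 := y + (coord z 0 - coord y 0) *: basis R 0.
pose w2 := w1 + (coord z 1 - coord y 1) *: basis R 1.
have z3 : z = w2 + (coord z 2%:R - coord y 2%:R) *: basis R 2%:R.
  rewrite /w2 /w1 /basis /coord /=; case: z {xz} w1 w2 => [[z0 z1] z2].
  case: y {xy} => [[y0 y1] y2] _ _ /=.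
  by congr (_, _, _) => /=; rewrite /GRing.scale /= ?mulr1 ?mulr0; ring.
have xw u q : ocube x e u -> ocube x e (u + (coord z q - coord y q) *: basis R q)
    \/ coord u q != coord y q.
  move=> xu; have [uq|] := eqVneq (coord u q) (coord y q); [left=> p|by right].
  rewrite coordD coordZ coord_basis /kron.
  have [<-|_] := eqVneq q p; last by rewrite mulr0 addr0; exact: xu.
  by rewrite mulr1 uq subrKC; exact: xz.
have xw1 : ocube x e w1 by have [|/eqP] := xw y 0 xy.
have xw2 : ocube x e w2.
  have [//|/eqP[]] := xw w1 1 xw1.
  by rewrite /w1 coordD coordZ coord_basis mulr0 addr0.
have [xi0 xxi0 E0] := mvt_coord (df 0) xy xw1.
have [xi1 xxi1 E1] := mvt_coord (df 1) xw1 xw2.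
have xz' := xz; rewrite z3 in xz'.
have [xi2 xxi2 E2] := mvt_coord (df 2%:R) xw2 xz'.
exists (fun q => if q == 0 then xi0 else if q == 1 then xi1 else xi2).
  by apply: forall_I3.
rewrite sum_I3 /= -E0 -E1 -E2 -z3 -/w1 -/w2; ring.
Qed.

Lemma bdry_not_in Om y : open Om -> bdry Om y -> ~ Om y.
Proof. by move=> oOm [_]; rewrite ((interior_id Om).1 oOm). Qed.

Lemma C1_continuous_pd f : C1 f -> forall p, continuous (pd p f).
Proof. by move=> [_ H] p; exact: (H p).2. Qed.

Lemma smooth_C1 f : smooth f -> C1 f.
Proof. exact: (fun H => H [::]). Qed.


Lemma ocube_dist3 x y (e : R) : ocube x e y -> dist3 x y <= 2 * e.
Proof. by move=> H; apply: norm3_le => p; rewrite coordB ltW. Qed.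

(** A negative value would put y in the open set Om; a positive one would give y a neighbourhood
    disjoint from Om, although y is in its closure. *)
Lemma local_defining_eq0 Om x rho (e : R) y : open Om -> continuous rho ->
  (forall z, ocube x e z -> (Om z <-> rho z < 0)) ->
  ocube x e y -> bdry Om y -> rho y = 0.
Proof.
move=> oOm crho Hr xy By; apply/eqP; rewrite eq_le; apply/andP; split; last first.
  by rewrite leNgt; apply/negP => /(Hr _ xy); exact: bdry_not_in.
rewrite leNgt; apply/negP => rho0; case: By => + _.
have nb : nbhs y ([set z | 0 < rho z] `&` ocube x e).
  apply: filterI; last by apply: open_nbhs_nbhs; split => //; exact: ocube_open.
  apply: (crho y [set r | 0 < r]); apply: open_nbhs_nbhs; split=> //; exact: open_gt.
move=> /(_ _ nb)[z [Oz [/= z0 xz]]].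
by have := (Hr z xz).1 Oz; rewrite ltNge (ltW z0).
Qed.

(** Since rho vanishes at y and z, the mean value formula is a linear relation between the three
    coordinate differences. The coefficient of the p-th one is bounded away from zero near x, so the
    other two control it. *)
Lemma local_Lipschitz_graph Om x : open Om -> smooth_bdry Om -> bdry Om x ->
  exists e L p, [/\ 0 < e, 0 <= L & forall y z s,
    (bdry Om `&` ocube x e) y -> (bdry Om `&` ocube x e) z ->
    (forall q, q != p -> `|coord y q - coord z q| <= s) ->
    dist3 y z <= L * s].
Proof.
move=> oOm sOm Bx; have [rho [srho grad0 [r [r0 Hr]]]] := sOm x Bx.
have C1rho := smooth_C1 srho.
have [p p0] : exists p, pd p rho x != 0.
  apply: contrapT => H; move: grad0; rewrite /norm3 /dot.
  have E p : pd p rho x = 0 by apply/eqP/negPn/negP => Hp; apply: H; exists p.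
  by rewrite sum_I3 /gradient !E !mulr0 !addr0 sqrtr0 eqxx.
(* Half of the derivative at x: where it varies by less than c, its absolute value stays at least
   c. *)
pose c := `|pd p rho x| / 2; have c0 : 0 < c by rewrite divr_gt0// normr_gt0.
have near_pd q : exists2 e : R, 0 < e & forall y, ocube x e y ->
    `|pd q rho x - pd q rho y| < c.
  have /cvgrPdist_lt/(_ c c0) := @C1_continuous_pd _ C1rho q x.
  by move=> /nbhs_coordP.
have [e0 e00 H0] := near_pd 0; have [e1 e10 H1] := near_pd 1.
have [e2 e20 H2] := near_pd 2%:R.
(* With e <= r / 4, points of the cube are within 2 e <= r / 2 < r of x, where rho describes Om. *)
pose e := Num.min (Num.min e0 e1) (Num.min e2 (r / 4)).
have e_gt0 : 0 < e by rewrite !lt_min e00 e10 e20 divr_gt0.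
have le_e y d : e <= d -> ocube x e y -> ocube x d y.
  by move=> ed xy q; apply: lt_le_trans ed.
have Hpd q y : ocube x e y -> `|pd q rho x - pd q rho y| < c.
  move: q; apply: forall_I3 => xy.
  - by apply: H0; apply: le_e xy; rewrite !ge_min lexx.
  - by apply: H1; apply: le_e xy; rewrite !ge_min lexx ?orbT.
  - by apply: H2; apply: le_e xy; rewrite !ge_min lexx ?orbT.
have Hrho z : ocube x e z -> (Om z <-> rho z < 0).
  move=> xz; apply: Hr; apply: le_lt_trans (ocube_dist3 xz) _.
  have : e <= r / 4 by rewrite !ge_min lexx !orbT.
  lra.
pose M := \sum_(q < 3) `|pd q rho x| + c.
have Mpd q y : ocube x e y -> `|pd q rho y| <= M.
  move=> xy; rewrite /M (bigD1 q)//= -addrA.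
  have := Hpd q y xy; rewrite distrC => /ltW /(le_trans (lerB_dist _ _)).
  rewrite lerBlDl => /le_trans; apply; rewrite lerD2l lerDr.
  exact: sumr_ge0.
have M0 : 0 <= M by apply: le_trans (Mpd p x (ocubexx _ e_gt0)).
have cpd y : ocube x e y -> c <= `|pd p rho y|.
  move=> /(Hpd p) /ltW /(le_trans (lerB_dist _ _)).
  by rewrite lerBlDr -lerBlDl {1}[`|_|]splitr addrK.
have dpd q z : derivable rho z (basis R q) by have [_ /(_ q)[]] := C1rho.
(* The p-th difference is at most (2 M / c) s and the others at most s, so 1 + 2 M / c serves for
   all three; the outer 2 is that of [norm3_le]. *)
exists e, (2 * (1 + 2 * M / c)), p; split=> //.
  by rewrite mulr_ge0// addr_ge0// divr_ge0 ?mulr_ge0// ltW.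
move=> y z s [By xy] [Bz xz] yzs.
have s0 : 0 <= s.
  have /andP[Hp _] := add1_neq p.
  exact: le_trans (yzs _ Hp).
have [xi xxi] := mean_value dpd xy xz.
rewrite (local_defining_eq0 oOm C1rho.1 Hrho xy By).
rewrite (local_defining_eq0 oOm C1rho.1 Hrho xz Bz) subr0.
(* A stands for the p-th derivative: |A| |a| <= |B| |b| + |D| |d| <= 2 M s. With bare reals, each
   value of p is an instance after permuting the sum. *)
have key (a b d A B D : R) : 0 = A * a + B * b + D * d -> c <= `|A| ->
    `|B| <= M -> `|D| <= M -> `|b| <= s -> `|d| <= s -> `|a| <= 2 * M / c * s.
  move=> E cA BM DM bs ds.
  rewrite mulrAC ler_pdivlMr//.
  have H : `|A| * `|a| <= 2 * M * s.
    rewrite -normrM (_ : A * a = - (B * b) - D * d); last by lra.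
    apply: le_trans (ler_normB _ _) _; rewrite normrN !normrM.
    have : `|B| * `|b| <= M * s by apply: ler_pM.
    have : `|D| * `|d| <= M * s by apply: ler_pM.
    by lra.
  apply: le_trans H; rewrite mulrC; exact: ler_wpM2r.
have zp : `|coord y p - coord z p| <= 2 * M / c * s -> dist3 y z <= 2 * (1 + 2 * M / c) * s.
  move=> H; rewrite -mulrA; apply: norm3_le => q; rewrite coordB.
  have [->|qp] := eqVneq q p.
    by apply: le_trans H _; rewrite [leRHS]mulrDl mul1r lerDr.
  apply: le_trans (yzs q qp) _; rewrite [leRHS]mulrDl mul1r lerDl.
  by rewrite mulr_ge0// divr_ge0 ?mulr_ge0// ltW.
move=> E; apply: zp; rewrite distrC; move: E; rewrite sum_I3 => E.
have yzs' q : q != p -> `|coord z q - coord y q| <= s.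
  by move=> /yzs; rewrite distrC.
clearbody c.
move: (cpd _ (xxi p)) yzs' (fun q => Mpd q _ (xxi q)) E; clear -key.
move: p; apply: forall_I3 => cp ys Mp E.
- by apply: (key _ _ _ _ _ _ E); rewrite ?ys.
- by rewrite -addrA addrCA addrA in E; apply: (key _ _ _ _ _ _ E); rewrite ?ys.
- by rewrite addrC addrA in E; apply: (key _ _ _ _ _ _ E); rewrite ?ys.
Qed.

Lemma area_bdry_fin Om : open Om -> bounded_set Om -> smooth_bdry Om ->
  (hausdorff2 (bdry Om) < +oo)%E.
Proof.
(* Off the boundary the radius takes the dummy value 1. *)
move=> oOm bOm sOm; pose e x := if pselect (bdry Om x) is left Bx then
  projT1 (cid (local_Lipschitz_graph oOm sOm Bx)) else 1.
have He x : bdry Om x -> 0 < e x /\ (hausdorff2 (bdry Om `&` ocube x (e x)) < +oo)%E.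
  rewrite /e; case: pselect => // Bx _; case: cid => d /= [L [p [d0 L0 H]]].
  by split=> //; apply: hausdorff2_Lipschitz_piece d0 L0 _ H; exact: subIsetr.
have [x Bx||s sB Bs] := @compact_finite_cover _ (bdry Om) (fun x => ocube x (e x)).
- exact: bdry_compact.
- by move=> x /He[e0 _]; split; [exact: ocube_open|exact: ocubexx].
have : forall t : seq (E3 R), (forall x, x \in t -> bdry Om x) ->
    (hausdorff2 (bdry Om `&` [set y | exists2 x, x \in t & ocube x (e x) y]) < +oo)%E.
  elim=> [_|x t IH xtB].
    rewrite (_ : _ `&` _ = set0) ?hausdorff2_set0//.
    by apply/seteqP; split=> // y [_ [?]]; rewrite in_nil.
  apply: (@le_lt_trans _ _ (hausdorff2 (bdry Om `&` ocube x (e x)) + hausdorff2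
      (bdry Om `&` [set y | exists2 x, x \in t & ocube x (e x) y]))%E).
    apply: le_trans (outer_measureU2 (@hausdorff2_outer R) _ _).
    apply: le_hausdorff2 => y [By [u]]; rewrite in_cons => /orP[/eqP->|ut] uy.
      by left.
    by right; split=> //; exists u.
  apply: lte_add_pinfty; first by have [] := He x (xtB x (mem_head _ _)).
  by apply: IH => u ut; apply: xtB; rewrite in_cons ut orbT.
move=> /(_ s sB); apply: le_lt_trans; apply: le_hausdorff2 => y By.
by split=> //; exact: Bs.
Qed.

End LocalGraph.

(** * A C^1 extension of the normal field *)

Section C1Functions.
Variable R : realType.
Implicit Types (x y : E3 R) (p q : 'I_3) (f g : E3 R -> R).

Lemma C1_intro f (df : 'I_3 -> E3 R -> R) : continuous f ->
  (forall p x, is_derive x (basis R p) f (df p x)) ->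
  (forall p, continuous (df p)) -> C1 f /\ forall p, pd p f = df p.
Proof.
move=> cf Hf cdf; have E p : pd p f = df p.
  by apply/funext => x; rewrite /pd; have [_ ->] := Hf p x.
split=> //; split=> // p; split; last by rewrite E.
by move=> x; have [] := Hf p x.
Qed.

Lemma C1_is_derive f p x : C1 f -> is_derive x (basis R p) f (pd p f x).
Proof. by move=> [_ /(_ p)[df _]]; exact: derivableP. Qed.

Lemma C1_cst (a : R) : C1 (fun _ : E3 R => a).
Proof.
apply: (C1_intro (df := fun _ _ => 0) _ _ _).1 => [x|p x].
  exact: cvg_cst.
exact: cvg_cst.
Qed.

Lemma C1D_pd f g : C1 f -> C1 g -> C1 (fun x => f x + g x) /\
  forall p, pd p (fun x => f x + g x) = fun x => pd p f x + pd p g x.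
Proof.
move=> Cf Cg; apply: (C1_intro (df := fun p x => pd p f x + pd p g x)).
- by move=> x; apply: cvgD; [exact: Cf.1|exact: Cg.1].
- by move=> p x; apply: is_deriveD; exact: C1_is_derive.
- by move=> p x; apply: cvgD; exact: C1_continuous_pd.
Qed.

Lemma C1M_pd f g : C1 f -> C1 g -> C1 (fun x => f x * g x) /\
  forall p, pd p (fun x => f x * g x) = fun x => f x * pd p g x + g x * pd p f x.
Proof.
move=> Cf Cg; apply: (C1_intro (df := fun p x => f x * pd p g x + g x * pd p f x)).
- by move=> x; apply: cvgM; [exact: Cf.1|exact: Cg.1].
- by move=> p x; apply: is_deriveM; exact: C1_is_derive.
- by move=> p x; apply: cvgD; apply: cvgM;
    by [exact: C1_continuous_pd|exact: Cf.1|exact: Cg.1].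
Qed.

Lemma C1D f g : C1 f -> C1 g -> C1 (fun x => f x + g x).
Proof. by move=> Cf Cg; have [] := C1D_pd Cf Cg. Qed.

Lemma C1M f g : C1 f -> C1 g -> C1 (fun x => f x * g x).
Proof. by move=> Cf Cg; have [] := C1M_pd Cf Cg. Qed.

Lemma C1_sum (I : eqType) (s : seq I) (F : I -> E3 R -> R) :
  (forall i, i \in s -> C1 (F i)) -> C1 (fun x => \sum_(i <- s) F i x).
Proof.
elim: s => [|i s IH] CF.
  rewrite (_ : (fun _ => _) = fun _ => 0); first exact: C1_cst.
  by apply/funext => x; rewrite big_nil.
rewrite (_ : (fun _ => _) = fun x => F i x + \sum_(j <- s) F j x).
  apply: C1D; first by apply: CF; rewrite mem_head.
  by apply: IH => j js; apply: CF; rewrite in_cons js orbT.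
by apply/funext => x; rewrite big_cons.
Qed.

Lemma C1_prod (I : Type) (s : seq I) (F : I -> E3 R -> R) :
  (forall i, C1 (F i)) -> C1 (fun x => \prod_(i <- s) F i x).
Proof.
move=> CF; elim: s => [|i s IH].
  rewrite (_ : (fun _ => _) = fun _ => 1); first exact: C1_cst.
  by apply/funext => x; rewrite big_nil.
rewrite (_ : (fun _ => _) = fun x => F i x * \prod_(j <- s) F j x).
  exact: C1M.
by apply/funext => x; rewrite big_cons.
Qed.

Lemma is_derive_coord x (v : E3 R) q : is_derive x v (fun y => coord y q) (coord v q).
Proof.
have cv : (fun h : R => h^-1 *: (((fun y => coord y q) \o shift x) (h *: v) - coord x q))
    @ 0^' --> (coord v q : R).
  apply: cvg_near_cst; near=> h.
  rewrite /shift /= coordD coordZ addrK [_ *: _]mulrA mulVf ?mul1r//.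
  by near: h; exact: nbhs_dnbhs_neq.
apply: DeriveDef; first by apply: cvgP cv.
exact: cvg_lim cv.
Unshelve. all: by end_near. Qed.

Lemma C1_coord_pd q : C1 (fun x => coord x q) /\
  forall p, pd p (fun x => coord x q) = fun _ => kron R p q.
Proof.
apply: (C1_intro (df := fun p x => kron R p q)).
- exact: continuous_coord.
- by move=> p x; rewrite -coord_basis; exact: is_derive_coord.
- by move=> p x; exact: cvg_cst.
Qed.

Lemma C1_coord q : C1 (fun x => coord x q).
Proof. by have [] := C1_coord_pd q. Qed.

(** Restriction of f to the line through x with direction v reduces this to the chain rule in one
    variable, at parameter 0. *)
Lemma is_derive_comp (k : R -> R) f x (v : E3 R) (dk df : R) :
  is_derive x v f df -> is_derive (f x) 1 k dk ->
  is_derive x v (k \o f) (dk * df).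
Proof.
move=> [df1 <-] Hk.
have E (g : E3 R -> R) : (fun h => h^-1 *: (((fun s : R => g (s *: v + x)) \o
     shift 0) (h *: 1) - g (0 *: v + x))) =
    (fun h => h^-1 *: ((g \o shift x) (h *: v) - g x)).
  apply/funext => h /=; rewrite /shift /= scale0r add0r addr0.
  by rewrite [_%:A]mulr1.
have Hf : is_derive (0 : R) 1 (fun s : R => f (s *: v + x)) ('D_v f x).
  by apply: DeriveDef; [rewrite /derivable E|rewrite /derive E].
have := @is_derive1_comp R k (fun s => f (s *: v + x)) 0 dk ('D_v f x).
rewrite scale0r add0r => /(_ Hk Hf)[H1 H2]; apply: DeriveDef.
  by move: H1; rewrite /derivable (E (k \o f)).
by move: H2; rewrite /derive (E (k \o f)).
Qed.

Lemma C1_comp (k dk : R -> R) f : C1 f ->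
  (forall x, is_derive (f x) 1 k (dk (f x))) ->
  (forall x, {for f x, continuous dk}) -> C1 (k \o f).
Proof.
move=> Cf Hk cdk.
apply: (C1_intro (df := fun p x => dk (f x) * pd p f x) _ _ _).1.
- move=> x; apply: continuous_comp; first exact: Cf.1.
  by apply/differentiable_continuous/derivable1_diffP; have [] := Hk x.
- by move=> p x; exact: is_derive_comp (C1_is_derive p x Cf) (Hk x).
- move=> p x; apply: cvgM; last exact: C1_continuous_pd.
  by apply: (@continuous_comp _ _ _ f dk); [exact: Cf.1|exact: cdk].
Qed.

(** The square of the positive part of t: a C^1 function that is positive exactly for t > 0, used
    both for cut-offs and for keeping a denominator positive. *)
Definition pos2 (t : R) : R := t * Num.max t 0.

Lemma pos2_ge0 t : 0 <= pos2 t.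
Proof. by rewrite /pos2; have [?|?] := leP t 0; nra. Qed.

Lemma pos2_gt0 t : (0 < pos2 t) = (0 < t).
Proof.
rewrite /pos2; have [t0|t0] := leP t 0; first by rewrite mulr0 ltxx.
by rewrite mulr_gt0.
Qed.

(** The difference quotient differs from the derivative by at most |h|, whatever the signs of t and
    h + t. *)
Lemma is_derive_pos2 (t : R) : is_derive t 1 pos2 (2 * Num.max t 0).
Proof.
have cv : (fun h : R => h^-1 *: ((pos2 \o shift t) (h *: 1) - pos2 t))
    @ 0^' --> (2 * Num.max t 0 : R).
  apply/cvgrPdist_lt => e e0; near=> h.
  have h0 : h != 0 by near: h; exact: nbhs_dnbhs_neq.
  have he : `|h| < e by near: h; exact: dnbhs0_lt.
  apply: le_lt_trans he; rewrite /shift /= [_%:A]mulr1.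
  rewrite -(ler_pM2l (_ : 0 < `|h|)) ?normr_gt0// -normrM mulrBr [h * (h^-1 *: _)]mulVKf//.
  have -> : `|h| * `|h| = h ^+ 2 by rewrite -normrM -expr2 ger0_norm ?sqr_ge0.
  rewrite ler_norml /pos2; apply/andP; have [?|?] := leP t 0;
    have [?|?] := leP (h + t) 0; split; nra.
apply: DeriveDef; first by apply: cvgP cv.
exact: cvg_lim cv.
Unshelve. all: by end_near. Qed.

Lemma continuous_max0 : continuous (fun t : R => 2 * Num.max t 0).
Proof.
move=> t; apply: cvgM; first exact: cvg_cst.
apply: (@continuous_max R R (fun s => s) (fun _ => 0) t).
  exact: cvg_id.
exact: cvg_cst.
Qed.

Lemma C1_pos2 f : C1 f -> C1 (fun x => pos2 (f x)).
Proof.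
move=> Cf; apply: (C1_comp (k := pos2) (dk := fun t => 2 * Num.max t 0)) => // x.
  exact: is_derive_pos2.
exact: continuous_max0.
Qed.

Lemma C1_invsqrt f : C1 f -> (forall x, 0 < f x) ->
  C1 (fun x => (Num.sqrt (f x))^-1).
Proof.
move=> Cf f0.
apply: (C1_comp (k := fun t => (Num.sqrt t)^-1)
  (dk := fun t => - (Num.sqrt t) ^- 2 * (2 * Num.sqrt t)^-1)) => // x.
  have s0 : Num.sqrt (f x) != 0 by rewrite gt_eqF// sqrtr_gt0.
  by have := @is_deriveV _ _ (f x) _ 1 s0 (is_derive1_sqrt (f0 x)).
have s0 : Num.sqrt (f x) != 0 by rewrite gt_eqF// sqrtr_gt0.
have cs : {for f x, continuous (@Num.sqrt R)} by exact: sqrt_continuous.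
apply: cvgM; last by apply: cvgV; [rewrite mulf_neq0|apply: cvgM => //; exact: cvg_cst].
apply: cvgN; apply: cvgV; first by rewrite expf_neq0.
by rewrite expr2; apply: cvgM.
Qed.

End C1Functions.

Section NormalExtension.
Variable R : realType.
Implicit Types (x y z : E3 R) (p q : 'I_3) (f rho : E3 R -> R) (Om : set (E3 R)).

Lemma norm3_eq0P (a : 'I_3 -> R) : (norm3 a != 0) <-> exists p, a p != 0.
Proof.
split=> [a0|[p ap]].
  apply: contrapT => H; move: a0; rewrite /norm3 /dot big1 ?sqrtr0 ?eqxx// => p _.
  by have -> : a p = 0 by [apply/eqP/negPn/negP => Hp; apply: H; exists p]; rewrite mul0r.
by rewrite gt_eqF//; apply: lt_le_trans (ler_norm3 a p); rewrite normr_gt0.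
Qed.

(** [outward_unit_normal] evaluates the normal at y through functions that define Om near y; this
    lets a single rho serve a whole cube around x. *)
Lemma local_defining_near Om x rho : local_defining Om x rho ->
  exists2 e, 0 < e & forall y, ocube x e y -> local_defining Om y rho.
Proof.
move=> [srho /norm3_eq0P[p p0] [r [r0 Hr]]].
have c0 : 0 < `|pd p rho x| by rewrite normr_gt0.
have /cvgrPdist_lt/(_ _ c0) := @C1_continuous_pd _ _ (smooth_C1 srho) p x.
move=> /nbhs_coordP[e1 e10 H1].
exists (Num.min e1 (r / 8)); first by rewrite lt_min e10 divr_gt0.
move=> y xy; split=> //.
  apply/norm3_eq0P; exists p; apply/negP => /eqP y0.
  have : ocube x e1 y by move=> q; apply: lt_le_trans (xy q) _; rewrite ge_min lexx.
  by move=> /H1; rewrite -/(gradient rho y p) y0 subr0 ltxx.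
(* The coordinates of x and y, and those of y and z, differ by less than r / 8, so x and z are at
   distance at most 2 (r / 4) < r. *)
exists (r / 8); split=> [|z yz]; first by rewrite divr_gt0.
apply: Hr; apply: (@le_lt_trans _ _ (2 * (r / 4))); last by lra.
apply: norm3_le => q; rewrite coordB.
have {}xy : `|coord x q - coord y q| < r / 8.
  by apply: lt_le_trans (xy q) _; rewrite ge_min lexx orbT.
have {}yz := le_lt_trans (coord_dist3 y z q) yz.
by apply: le_trans (ler_distD (coord y q) _ _) _; lra.
Qed.

(** A product over coordinates, so that the set of positivity is precisely the open cube used in the
    finite cover. *)
Definition bump x (e : R) y : R :=
  \prod_(q <- enum 'I_3) pos2 (e ^+ 2 - (coord y q - coord x q) ^+ 2).

Lemma bump_C1 x (e : R) : C1 (bump x e).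
Proof.
apply: C1_prod => q; apply: C1_pos2; apply: C1D; first exact: C1_cst.
have Cd : C1 (fun y => coord y q - coord x q).
  by apply: C1D; [exact: C1_coord|exact: C1_cst].
rewrite (_ : (fun _ => _) = fun y =>
    -1 * ((coord y q - coord x q) * (coord y q - coord x q))).
  by apply: C1M; [exact: C1_cst|exact: C1M].
by apply/funext => y; rewrite mulN1r expr2.
Qed.

Lemma bump_ge0 x (e : R) y : 0 <= bump x e y.
Proof. by apply: prodr_ge0 => q _; exact: pos2_ge0. Qed.

Lemma bump_gt0 x (e : R) y : 0 < e -> (0 < bump x e y <-> ocube x e y).
Proof.
move=> e0; have sq (t : R) : (0 < e ^+ 2 - t ^+ 2) = (`|t| < e).
  by rewrite subr_gt0 -[t ^+ 2]real_normK ?num_real// ltr_pXn2r ?nnegrE// ltW.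
split=> [b0 q|xy].
  rewrite distrC -sq -pos2_gt0 lt_def pos2_ge0 andbT; apply/negP => /eqP q0.
  move: b0; rewrite /bump (bigD1_seq q) ?mem_enum ?enum_uniq//= q0 mul0r.
  by rewrite ltxx.
by apply: prodr_gt0 => q _; rewrite pos2_gt0 sq distrC; exact: xy.
Qed.

(* On the boundary the gradients of all local defining functions point in the
   direction of [n]; so does their sum weighted with bump functions, which is
   defined everywhere and only has to be normalised. *)
Lemma normal_scaled_extension Om (n : vfield R) :
  bounded_set Om -> smooth_bdry Om -> outward_unit_normal Om n ->
  exists (V : vfield R) (lam : E3 R -> R), (forall q, C1 (V q)) /\
    forall x, bdry Om x -> 0 < lam x /\ forall q, V q x = lam x * n q x.
Proof.
move=> bOm sOm nOm.
have ex x : exists re : (E3 R -> R) * R, bdry Om x ->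
    [/\ smooth re.1, 0 < re.2 &
      forall y, ocube x re.2 y -> local_defining Om y re.1].
  have [Bx|nB] := pselect (bdry Om x); last by exists (cst 0, 1).
  have [rho Hrho] := sOm x Bx; have [e e0 He] := local_defining_near Hrho.
  by exists (rho, e) => _; split => //; case: Hrho.
have [F HF] := choice ex.
have [x Bx||s sB Bs] := @compact_finite_cover _ (bdry Om)
    (fun x => ocube x (F x).2).
- exact: bdry_compact.
- by move=> x /HF[_ e0 _]; split; [exact: ocube_open|exact: ocubexx].
exists (fun q y => \sum_(x <- s) bump x (F x).2 y * pd q (F x).1 y).
exists (fun y => \sum_(x <- s) bump x (F x).2 y * norm3 (gradient (F x).1 y)).
split=> [q|y By].
  apply: C1_sum => x xs; apply: C1M; first exact: bump_C1.
  by have [srho _ _] := HF x (sB x xs); exact: (srho [:: q]).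
split.
  have term_ge0 x : 0 <= bump x (F x).2 y * norm3 (gradient (F x).1 y).
    by rewrite mulr_ge0 ?bump_ge0 ?norm3_ge0.
  have [x xs xy] := Bs y By; have [_ e0 He] := HF x (sB x xs).
  rewrite (big_rem x)//=; apply: ltr_pwDl; last exact: sumr_ge0.
  rewrite mulr_gt0//; first exact/bump_gt0.
  by have [_ g0 _] := He y xy; rewrite lt_def g0 norm3_ge0.
move=> q; rewrite mulr_suml; apply: eq_big_seq => x xs.
have [_ e0 He] := HF x (sB x xs).
(* Either the weight vanishes at y, or y lies in the cube of x, where the gradient is its norm times
   n. *)
have := bump_ge0 x (F x).2 y; rewrite le_eqVlt => /orP[/eqP<-|].
  by rewrite !mul0r.
move=> /(bump_gt0 _ _ e0) /He Hy; rewrite (nOm y By _ Hy q) -mulrA.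
by congr (_ * _); case: Hy => _ g0 _; rewrite mulrC divfK.
Qed.

Lemma outward_unit_normal_norm Om (n : vfield R) x : smooth_bdry Om ->
  outward_unit_normal Om n -> bdry Om x -> dot (n ^~ x) (n ^~ x) = 1.
Proof.
move=> sOm nOm Bx; have [rho Hrho] := sOm x Bx.
rewrite /dot; under eq_bigr do rewrite (nOm x Bx rho Hrho) mulrACA.
rewrite -mulr_suml -/(dot _ _) -sqr_norm3 -expr2 -exprMn divff ?expr1n//.
by case: Hrho.
Qed.

(** V may vanish away from S, so V / |V| need not make sense there; |V|^2 is therefore replaced by a
    positive C^1 function that agrees with it on S. *)
Lemma normal_C1_extension Om (n : vfield R) :
  bounded_set Om -> smooth_bdry Om -> outward_unit_normal Om n ->
  exists N : vfield R, (forall q, C1 (N q)) /\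
    forall x, bdry Om x -> forall q, N q x = n q x.
Proof.
move=> bOm sOm nOm; have [V [lam [CV HV]]] := normal_scaled_extension bOm sOm nOm.
pose v x := \sum_(q <- enum 'I_3) V q x * V q x.
have Cv : C1 v by apply: C1_sum => q _; exact: C1M.
have vE x : bdry Om x -> v x = lam x ^+ 2.
  move=> Bx; have [l0 Vx] := HV x Bx; rewrite /v big_enum /=.
  under eq_bigr do rewrite Vx mulrACA.
  by rewrite -mulr_sumr -/(dot (n ^~ x) (n ^~ x))
    (outward_unit_normal_norm sOm nOm Bx) mulr1 expr2.
(* c is the minimum of |V|^2 on the compact set S, where |V|^2 = lam^2 > 0, and 1 if S is empty. *)
have [c c0 cv] : exists2 c, 0 < c & forall x, bdry Om x -> c <= v x.
  have [[x0 Bx0]|nB] := pselect (bdry Om !=set0); last first.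
    by exists 1 => // x Bx; case: nB; exists x.
  have [|||x] := @compact_EVT_min _ R v (bdry Om).
  - by exists x0.
  - exact: bdry_compact.
  - by apply: continuous_subspaceT; exact: Cv.1.
  rewrite inE => Bx minx; exists (v x); first by rewrite vE// exprn_gt0// (HV x Bx).1.
  by move=> y By; apply: minx; rewrite inE.
(* [t + (c - t)_+ ^ 2 / c] is a positive [C^1] function of [t] that equals [t]
   for [t >= c]. *)
pose w x := v x + c^-1 * pos2 (c - v x).
have Cw : C1 w.
  apply: C1D => //; apply: C1M; first exact: C1_cst.
  apply: C1_pos2; apply: C1D; first exact: C1_cst.
  rewrite (_ : (fun _ => _) = fun x => -1 * v x); last by apply/funext => x; rewrite mulN1r.
  by apply: C1M => //; exact: C1_cst.
have w0 x : 0 < w x.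
  have ci : 0 < c^-1 by rewrite invr_gt0.
  (* c w equals c v for v >= c and v^2 - c v + c^2 for v < c; both are positive. *)
  rewrite -(pmulr_rgt0 _ c0) /w mulrDr mulVKf ?gt_eqF// /pos2.
  by have [?|?] := leP (c - v x) 0; nra.
exists (fun q x => V q x * (Num.sqrt (w x))^-1); split=> [q|x Bx q].
  by apply: C1M => //; exact: C1_invsqrt.
have [l0 Vx] := HV x Bx.
have -> : w x = lam x ^+ 2.
  rewrite /w /pos2 max_r ?mulr0 ?addr0 ?vE//; rewrite subr_le0 -vE//; exact: cv.
by rewrite sqrtr_sqr gtr0_norm// Vx mulrAC divff ?mul1r// gt_eqF.
Qed.

End NormalExtension.

(** * C^1 functions on a bounded domain *)

Section LebesgueE3.
Variable R : realType.
Local Notation mu := (@lebesgue_measure R).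
Implicit Types (x y : E3 R) (p q : 'I_3) (f g : E3 R -> R) (Om : set (E3 R)).

Lemma lebesgue_itv_fin (M : R) : (mu `[(- M)%R, M]%classic < +oo)%E.
Proof. by rewrite lebesgue_measure_itv; case: ifP => _; rewrite ltry. Qed.

Lemma measurable_square (M : R) :
  measurable (square M : set (measurableTypeR R * measurableTypeR R)).
Proof. by apply: measurableX; exact: measurable_itv. Qed.

Lemma square_fin (M : R) : ((mu \x mu) (square M) < +oo)%E.
Proof.
rewrite product_measure1E; [|exact: measurable_itv..].
by rewrite lte_mul_pinfty// ?ge0_fin_numE ?lebesgue_itv_fin.
Qed.

(* An alias, because the library does not infer that the product of two
   sigma-finite measures is sigma-finite, as Fubini's theorem on R^3 requires. *)
Definition lebesgue2 : set (measurableTypeR R * measurableTypeR R) -> \bar R :=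
  (mu \x mu)%E.

HB.instance Definition _ := Measure.on lebesgue2.

Lemma lebesgue2_sigma_finite : sigma_finite setT lebesgue2.
Proof.
exists (fun k => square k%:R); last first.
  by move=> k; split; [exact: measurable_square|exact: square_fin].
apply/seteqP; split=> // -[a b] _.
pose k := (Num.truncn `|a| + Num.truncn `|b|).+1.
exists k => //; split=> /=; rewrite in_itv /= -ler_norml ltW//.
  by apply: lt_le_trans (truncnS_gt _) _; rewrite ler_nat ltnS leq_addr.
by apply: lt_le_trans (truncnS_gt _) _; rewrite ler_nat ltnS leq_addl.
Qed.

HB.instance Definition _ := @Measure_isSigmaFinite.Build _ _ R lebesgue2
  lebesgue2_sigma_finite.

Lemma measurable_cube (M : R) :
  measurable (cube M : set (E3 (measurableTypeR R))).
Proof.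
by rewrite cubeE; apply: measurableX; [exact: measurable_square|exact: measurable_itv].
Qed.

Lemma leb3_cube_fin (M : R) : (leb3 R (cube M) < +oo)%E.
Proof.
have -> : leb3 R (cube M) =
    ((mu \x mu) \x mu)%E (square M `*` `[- M, M]) by rewrite cubeE.
rewrite product_measure1E; [|exact: measurable_square|exact: measurable_itv].
by rewrite lte_mul_pinfty// ?ge0_fin_numE ?lebesgue_itv_fin// square_fin.
Qed.

Lemma leb3_bounded_fin Om : open Om -> bounded_set Om -> (leb3 R Om < +oo)%E.
Proof.
move=> oOm /bounded_set_cube[M _ OmM].
apply: le_lt_trans (leb3_cube_fin M); apply: le_measure => //; rewrite inE.
  exact: open_measurable_leb.
exact: measurable_cube.
Qed.

Lemma continuous_bounded_cube f (M : R) : continuous f ->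
  exists2 C, 0 <= C & forall x, cube M x -> `|f x| <= C.
Proof.
move=> cf; have [[x0 Bx0]|nB] := pselect (cube M !=set0); last first.
  by exists 0 => // x cx; case: nB; exists x.
have [|||c _ maxc] := @compact_EVT_max _ R (fun x => `|f x|) (cube M).
- by exists x0.
- exact: cube_compact.
- by apply: continuous_subspaceT => x; apply: cvg_norm; exact: cf.
by exists `|f c| => // x cx; apply: maxc; rewrite inE.
Qed.

Lemma integrable_supported d (T : measurableType d)
    (m : {measure set T -> \bar R}) (A : set T) (f : T -> R) (C : R) :
  measurable A -> (m A < +oo)%E -> measurable_fun setT f ->
  (forall t, A t -> `|f t| <= C) -> (forall t, ~ A t -> f t = 0) ->
  m.-integrable setT (EFin \o f).
Proof.
move=> mA Afin mf fC f0.
have -> : EFin \o f = (EFin \o f) \_ A.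
  by apply/funext => x; rewrite patchE; case: ifPn => // /negP;
    rewrite inE => /f0 /= ->.
have iA : m.-integrable A (EFin \o f); last by apply/(integrable_mkcond _ mA).
apply: measurable_bounded_integrable => //.
  exact: measurable_funS mf.
exists C; split; first by rewrite num_real.
by move=> y Cy x Ax; apply: le_trans (ltW Cy); exact: fC.
Qed.

Lemma integral_derive_eq0 (phi dphi : R -> R) (M : R) : 0 < M ->
  (forall t : R, is_derive t 1 phi (dphi t)) -> continuous dphi ->
  (forall t, M <= `|t| -> phi t = 0) -> (forall t, M < `|t| -> dphi t = 0) ->
  (\int[mu]_t (dphi t)%:E = 0)%E.
Proof.
move=> M0 Hphi cdphi phi0 dphi0.
have -> : (fun t => (dphi t)%:E) = (fun t => (dphi t)%:E) \_ `[- M, M].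
  apply/funext => t; rewrite patchE; case: ifPn => // /negP.
  rewrite inE /= in_itv /= -ler_norml => /negP; rewrite -ltNge => /dphi0.
  by move=> ->.
rewrite -integral_mkcond.
have cphi : continuous phi.
  by move=> t; apply/differentiable_continuous/derivable1_diffP; have [] := Hphi t.
rewrite (@continuous_FTC2 _ dphi phi).
- by rewrite !phi0 ?normrN ?gtr0_norm// subee.
- by rewrite gtrN.
- exact: continuous_subspaceT.
- split; first by move=> t _; have [] := Hphi t.
    by apply: cvg_at_right_filter; exact: cphi.
  by apply: cvg_at_left_filter; exact: cphi.
- by move=> t _; rewrite derive1E; have [_ ->] := Hphi t.
Qed.

Lemma pd_eq0_off_cube f p (M : R) x : (forall y, ~ cube M y -> f y = 0) ->
  ~ cube M x -> pd p f x = 0.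
Proof.
move=> f0 nx; rewrite /pd (@near_eq_derive _ _ _ f (cst 0)).
  by rewrite derive_cst.
have : nbhs x (~` cube M).
  apply: open_nbhs_nbhs; split=> //; exact/closed_openC/cube_closed.
by apply: filterS => y /f0 ->.
Qed.

(** Integrating along axis p innermost, each line integral of the derivative is a difference of two
    values of f outside its support. *)
Lemma integral_pd_eq0 f p (M : R) : C1 f -> 0 < M ->
  (forall x, ~ cube M x -> f x = 0) ->
  (\int[leb3 R]_x (pd p f x)%:E = 0)%E.
Proof.
move=> Cf M0 f0; have cpd := @C1_continuous_pd _ _ Cf p.
have [C C0 fC] := continuous_bounded_cube M cpd.
have pd0 x : ~ cube M x -> pd p f x = 0 by exact: pd_eq0_off_cube.
have mpd := continuous_measurable_leb cpd.
have ipd : (leb3 R).-integrable setT (EFin \o pd p f).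
  exact: (integrable_supported (measurable_cube M) (leb3_cube_fin M) mpd fC pd0).
pose phi a t := f (a + t *: basis R p).
pose dphi a t := pd p f (a + t *: basis R p).
have line a : coord a p = 0 -> (\int[mu]_t (dphi a t)%:E = 0)%E.
  move=> ap; have off t : M < `|t| -> ~ cube M (a + t *: basis R p).
    move=> Mt /(_ p); rewrite coordD coordZ coord_basis /kron eqxx ap mulr1 add0r.
    by rewrite leNgt Mt.
  have cline : continuous (fun t : R => a + t *: basis R p).
    move=> t; apply: cvgD; first exact: cvg_cst.
    by apply: cvgZr_tmp; exact: cvg_id.
  (* f vanishes for |t| > M, whereas the endpoints of the interval of integration must be zeros too;
     hence M + 1. *)
  apply: (@integral_derive_eq0 (phi a) _ (M + 1)).
  - by rewrite addr_gt0.
  - by move=> t; apply: is_derive_line; have [_ /(_ p)[]] := Cf.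
  - by move=> t; apply: continuous_comp; [exact: cline|exact: cpd].
  - by move=> t Mt; apply: f0; apply: off; lra.
  - by move=> t Mt; apply: pd0; apply: off; lra.
(* The measure is nested as (x, y) and z, so p = 0 and p = 1 call for a second use of Fubini's
   theorem in the plane at height z. *)
have section_integrable z :
    (mu \x mu)%E.-integrable setT (EFin \o (fun xy : R * R => pd p f (xy, z))).
  apply: (integrable_supported (measurable_square M) (square_fin M) (C := C)).
  - apply: (@measurable_fun_continuous_comp _ _ _
      (fun xy : measurableTypeR R * measurableTypeR R => (xy, z))) => //.
    apply: forall_I3 => /=;
      [exact: measurable_fst|exact: measurable_snd|exact: measurable_cst].
  - move=> [a b] ab; have [zM|zM] := leP `|z| M.
      by apply: fC; rewrite cubeE; split=> //=; rewrite in_itv /= -ler_norml.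
    rewrite pd0 ?normr0// => /(_ 2%:R) /=.
    by rewrite leNgt zM.
  - move=> [a b] ab; apply: pd0; rewrite cubeE => -[]; exact.
have ring_coord (x y : E3 R) t q : (forall r, coord y r + t * kron R q r = coord x r) ->
    y + t *: basis R q = x.
  by move=> H; apply: coord_inj => r; rewrite coordD coordZ coord_basis.
have E0 (x y z : R) : (0, y, z) + x *: basis R 0 = (x, y, z).
  by apply: ring_coord; apply: forall_I3; rewrite /kron /coord /=; ring.
have E1 (x y z : R) : (x, 0, z) + y *: basis R 1 = (x, y, z).
  by apply: ring_coord; apply: forall_I3; rewrite /kron /coord /=; ring.
have E2 (x y z : R) : (x, y, 0) + z *: basis R 2%:R = (x, y, z).
  by apply: ring_coord; apply: forall_I3; rewrite /kron /coord /=; ring.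
have [p0|[p1|p2]] : p = 0 \/ p = 1 \/ p = 2%:R.
  by move: (p); apply: forall_I3; tauto.
- rewrite -(@integral21_prod_meas1 _ _ _ _ R lebesgue2 mu _ ipd).
  apply: integral0_eq => z _; rewrite /fubini_G.
  rewrite -(@integral21_prod_meas1 _ _ _ _ R mu mu _ (section_integrable z)).
  apply: integral0_eq => y _; rewrite /fubini_G.
  apply: etrans (line (0, y, z) _); last by rewrite p0.
  apply: eq_integral => x _; by rewrite /dphi p0 E0.
- rewrite -(@integral21_prod_meas1 _ _ _ _ R lebesgue2 mu _ ipd).
  apply: integral0_eq => z _; rewrite /fubini_G.
  rewrite -(@integral12_prod_meas1 _ _ _ _ R mu mu _ (section_integrable z)).
  apply: integral0_eq => x _; rewrite /fubini_F.
  apply: etrans (line (x, 0, z) _); last by rewrite p1.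
  apply: eq_integral => y _; by rewrite /dphi p1 E1.
rewrite -(@integral12_prod_meas1 _ _ _ _ R lebesgue2 mu _ ipd).
apply: integral0_eq => -[x y] _; rewrite /fubini_F.
apply: etrans (line (x, y, 0) _); last by rewrite p2.
apply: eq_integral => z _; by rewrite /dphi p2 E2.
Qed.

Lemma integrable_continuous_bounded Om f : open Om -> bounded_set Om ->
  continuous f -> (leb3 R).-integrable Om (EFin \o f).
Proof.
move=> oOm bOm cf; have [M M0 OmM] := bounded_set_cube bOm.
have [C C0 fC] := continuous_bounded_cube M cf.
apply: measurable_bounded_integrable.
- exact: open_measurable_leb.
- exact: leb3_bounded_fin.
- by apply: measurable_funS (continuous_measurable_leb cf).
exists C; split; first by rewrite num_real.
by move=> y Cy x Omx; apply: le_trans (ltW Cy); apply: fC; exact: OmM.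
Qed.

Lemma L2_dom_continuous Om f : open Om -> bounded_set Om -> continuous f ->
  L2_dom Om f.
Proof.
move=> oOm bOm cf; split.
  by apply: measurable_funS (continuous_measurable_leb cf).
have cf2 : continuous (fun x => f x ^+ 2).
  by move=> x; exact: (cvgM (cf x) (cf x)).
have /integrableP[_] := integrable_continuous_bounded oOm bOm cf2.
apply: le_lt_trans; apply: ge0_le_integral => //.
- exact: open_measurable_leb.
- by move=> x _; rewrite lee_fin sqr_ge0.
- apply/measurable_EFinP; apply: measurable_funS (continuous_measurable_leb cf2) => //.
- apply: measurableT_comp => //; apply/measurable_EFinP.
  exact: measurable_funS (continuous_measurable_leb cf2).
- by move=> x _; rewrite /= lee_fin ler_norm.
Qed.

(** The product f g vanishes off a compact subset of Om, so the integral over Om of its derivative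
    is an integral over the whole space, which is zero. *)
Lemma int_dom_by_parts Om f g p : open Om -> bounded_set Om -> C1 f ->
  test_fun Om g ->
  int_dom Om (fun x => f x * pd p g x) = - int_dom Om (fun x => pd p f x * g x).
Proof.
move=> oOm bOm Cf [sg [K [cK KOm g0]]]; have Cg := smooth_C1 sg.
have [Cfg pdfg] := C1M_pd Cf Cg.
have [M M0 OmM] := bounded_set_cube bOm.
have mOm : measurable (Om : set (E3 (measurableTypeR R))) by exact: open_measurable_leb.
have K0 x : ~ K x -> pd p (fun y => f y * g y) x = 0.
  move=> nK; rewrite /pd (@near_eq_derive _ _ _ _ (cst 0)); first by rewrite derive_cst.
  have : nbhs x (~` K).
    apply: open_nbhs_nbhs; split=> //; apply: closed_openC.
    exact: (@compact_closed _ _ (@norm_hausdorff R (E3 R)) cK).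
  by apply: filterS => y /g0 ->; rewrite mulr0.
have I0 : int_dom Om (pd p (fun x => f x * g x)) = 0.
  rewrite /int_dom /Rintegral integral_mkcond.
  rewrite (_ : _ \_ _ = (fun x => (pd p (fun x => f x * g x) x)%:E)); last first.
    apply/funext => x; rewrite patchE; case: ifPn => // /negP; rewrite inE => nOm.
    by rewrite K0// => /KOm.
  rewrite (integral_pd_eq0 p Cfg M0)// => x nx; rewrite g0 ?mulr0// => /KOm.
  by move/OmM.
apply/eqP; rewrite -addr_eq0; apply/eqP; rewrite -[RHS]I0 /int_dom -RintegralD//.
- by congr (Rintegral _ _ _); apply/funext => x; rewrite pdfg [g x * _]mulrC.
- apply: integrable_continuous_bounded => // x.
  by apply: cvgM; [exact: Cf.1|exact: C1_continuous_pd].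
- apply: integrable_continuous_bounded => // x.
  by apply: cvgM; [exact: C1_continuous_pd|exact: Cg.1].
Qed.

Lemma C1_H1 Om f : open Om -> bounded_set Om -> C1 f -> H1 Om (classical f).
Proof.
move=> oOm bOm Cf; split; first exact: L2_dom_continuous Cf.1.
move=> p; split; first by apply: L2_dom_continuous => // x; exact: C1_continuous_pd.
by move=> g tg; exact: int_dom_by_parts.
Qed.

End LebesgueE3.

(** * Square integrable functions and traces *)

Section SquareIntegrable.
Context d (T : measurableType d) (R : realType) (m : {measure set T -> \bar R}).
Variable D : set T.
Hypothesis mD : measurable D.
Implicit Types f g s : T -> R.

(** The integrated form of (a + b)^2 <= 2 a^2 + 2 b^2. It gives sums and products of L^2 functions,
    and later the convergence of sums of approximating sequences. *)
Lemma le_integral_double s s1 s2 : measurable_fun D s ->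
  measurable_fun D s1 -> measurable_fun D s2 ->
  (forall x, 0 <= s x) -> (forall x, 0 <= s1 x) -> (forall x, 0 <= s2 x) ->
  (forall x, D x -> s x <= 2 * s1 x + 2 * s2 x) ->
  (\int[m]_(x in D) (s x)%:E <= 2%:E * \int[m]_(x in D) (s1 x)%:E +
                                2%:E * \int[m]_(x in D) (s2 x)%:E)%E.
Proof.
move=> ms ms1 ms2 s0 s10 s20 le_s.
have m1 : measurable_fun D (fun x => 2 * s1 x) by exact: measurable_funM.
have m2 : measurable_fun D (fun x => 2 * s2 x) by exact: measurable_funM.
rewrite -!ge0_integralZl_EFin//; try (by move=> x _; rewrite lee_fin);
  try exact/measurable_EFinP.
under [X in (_ <= X + _)%E]eq_integral do rewrite -EFinM.
under [X in (_ <= _ + X)%E]eq_integral do rewrite -EFinM.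
rewrite -ge0_integralD//; try (by move=> x _; rewrite lee_fin mulr_ge0);
  try exact/measurable_EFinP.
apply: ge0_le_integral => //.
- by move=> x _; rewrite lee_fin.
- exact/measurable_EFinP.
- by apply: emeasurable_funD; exact/measurable_EFinP.
Qed.

Lemma L2D f g : L2 m D f -> L2 m D g -> L2 m D (fun x => f x + g x).
Proof.
move=> [mf If] [mg Ig]; split; first exact: measurable_funD.
apply: le_lt_trans (@le_integral_double _ (fun x => f x ^+ 2) (fun x => g x ^+ 2)
  _ _ _ _ _ _ _) _.
- by apply: measurable_funX; exact: measurable_funD.
- exact: measurable_funX.
- exact: measurable_funX.
- by move=> x; exact: sqr_ge0.
- by move=> x; exact: sqr_ge0.
- by move=> x; exact: sqr_ge0.
- by move=> x _; have := sqr_ge0 (f x - g x); nra.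
by rewrite lte_add_pinfty// lte_mul_pinfty.
Qed.

Lemma L2_mul_integrable f g : L2 m D f -> L2 m D g ->
  m.-integrable D (EFin \o (fun x => f x * g x)).
Proof.
move=> [mf If] [mg Ig]; apply/integrableP; split.
  by apply/measurable_EFinP; exact: measurable_funM.
apply: le_lt_trans (@le_integral_double (fun x => `|f x * g x|)
  (fun x => f x ^+ 2) (fun x => g x ^+ 2) _ _ _ _ _ _ _) _.
- by apply: measurableT_comp => //; exact: measurable_funM.
- exact: measurable_funX.
- exact: measurable_funX.
- by move=> x; exact: normr_ge0.
- by move=> x; exact: sqr_ge0.
- by move=> x; exact: sqr_ge0.
- move=> x _; rewrite ler_norml; have := sqr_ge0 (f x - g x).
  by have := sqr_ge0 (f x + g x); nra.
by rewrite lte_add_pinfty// lte_mul_pinfty.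
Qed.

Lemma L2_bounded f (C : R) : (m D < +oo)%E -> measurable_fun D f ->
  (forall x, D x -> `|f x| <= C) -> L2 m D f.
Proof.
move=> Dfin mf fC; split=> //.
have mf2 : measurable_fun D (fun x => f x ^+ 2) by exact: measurable_funX.
have : m.-integrable D (EFin \o (fun x => f x ^+ 2)).
  apply: measurable_bounded_integrable => //.
  exists (C ^+ 2); split; first by rewrite num_real.
  move=> y Cy x Dx; apply: le_trans (ltW Cy); rewrite normrX.
  by rewrite ler_pXn2r ?nnegrE ?(le_trans _ (fC x Dx)) ?fC.
move=> /integrableP[_]; apply: le_lt_trans; apply: ge0_le_integral => //.
- by move=> x _; rewrite lee_fin sqr_ge0.
- exact/measurable_EFinP.
- by apply: measurableT_comp => //; exact/measurable_EFinP.
- by move=> x _; rewrite /= lee_fin ler_norm.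
Qed.

Lemma L2_mul_bounded f g (C : R) : L2 m D f -> measurable_fun D g ->
  (forall x, D x -> `|g x| <= C) -> L2 m D (fun x => f x * g x).
Proof.
move=> [mf If] mg gC; split; first exact: measurable_funM.
have mf2 : measurable_fun D (fun x => f x ^+ 2) by exact: measurable_funX.
apply: (@le_lt_trans _ _ (\int[m]_(x in D) (C ^+ 2 * f x ^+ 2)%:E)%E).
  apply: ge0_le_integral => //.
  - by move=> x _; rewrite lee_fin sqr_ge0.
  - by apply/measurable_EFinP; apply: measurable_funX; exact: measurable_funM.
  - by apply/measurable_EFinP; exact: measurable_funM.
  move=> x Dx; rewrite lee_fin exprMn mulrC ler_wpM2r ?sqr_ge0//.
  by rewrite -real_normK ?num_real// ler_pXn2r ?nnegrE ?(le_trans _ (gC x Dx)) ?gC.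
under eq_integral do rewrite EFinM.
rewrite ge0_integralZl_EFin ?sqr_ge0//; last 2 first.
- by move=> x _; rewrite lee_fin sqr_ge0.
- exact/measurable_EFinP.
by rewrite lte_mul_pinfty// lee_fin sqr_ge0.
Qed.

Lemma L2Z (c : R) f : L2 m D f -> L2 m D (fun x => c * f x).
Proof.
move=> Lf; rewrite (_ : (fun _ => _) = fun x => f x * c).
  exact: (@L2_mul_bounded _ (fun _ => c) `|c|).
by apply/funext => x; rewrite mulrC.
Qed.

Lemma L2_abs f : L2 m D f -> L2 m D (fun x => `|f x|).
Proof.
move=> [mf If]; split; first exact: measurableT_comp mf.
by under eq_integral do rewrite real_normK ?num_real//.
Qed.

Lemma L2_ae_bounded f (C : R) : (m D < +oo)%E -> measurable_fun D f ->
  {ae m, forall x, D x -> `|f x| <= C} -> L2 m D f.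
Proof.
move=> Dfin mf fC; split=> //.
apply: (@le_lt_trans _ _ (\int[m]_(x in D) (C ^+ 2)%:E)%E).
  apply: ae_ge0_le_integral => //.
  - by move=> x _; rewrite lee_fin sqr_ge0.
  - by apply/measurable_EFinP; exact: measurable_funX.
  - by move=> x _; rewrite lee_fin sqr_ge0.
  apply: filterS fC => x fC Sx; rewrite lee_fin -real_normK ?num_real//.
  by rewrite ler_pXn2r ?nnegrE ?(le_trans _ (fC Sx)) ?fC.
by rewrite integral_cst// lte_mul_pinfty// lee_fin sqr_ge0.
Qed.

Lemma L2_norm3 (F : 'I_3 -> T -> R) : (forall q, L2 m D (F q)) ->
  L2 m D (fun x => norm3 (F ^~ x)).
Proof.
move=> LF; have I q : m.-integrable D (EFin \o (fun x => F q x * F q x)).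
  exact: (L2_mul_integrable (LF q) (LF q)).
have E x : (norm3 (F ^~ x) ^+ 2)%:E = ((F 0 x * F 0 x)%:E +
    (F 1 x * F 1 x)%:E + (F 2%:R x * F 2%:R x)%:E)%E.
  by rewrite sqr_norm3 /dot sum_I3 !EFinD.
have m2 : measurable_fun D (fun x => \sum_(q < 3) F q x * F q x).
  by apply: measurable_sum => q; apply: measurable_funM; have [] := LF q.
split.
  have msq : measurable_fun setT (@Num.sqrt R).
    by apply: continuous_measurable_fun; exact: sqrt_continuous.
  exact: (measurableT_comp msq m2).
under eq_integral do rewrite E.
have /integrableP[mI] : m.-integrable D (fun x => (F 0 x * F 0 x)%:E +
    (F 1 x * F 1 x)%:E + (F 2%:R x * F 2%:R x)%:E)%E.
  by apply: integrableD => //; [apply: integrableD => //|]; exact: I.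
apply: le_lt_trans; apply: ge0_le_integral => //.
- by move=> x _; rewrite -E lee_fin sqr_ge0.
- by apply: measurableT_comp.
- by move=> x _; rewrite lee_abs.
Qed.

Lemma eq_L2 f g : (forall x, D x -> f x = g x) -> L2 m D f -> L2 m D g.
Proof.
move=> fg [mf If]; split.
  by apply: eq_measurable_fun mf => x; rewrite inE => /fg.
by move: If; congr (_ < _)%E; apply: eq_integral => x; rewrite inE => /fg ->.
Qed.

End SquareIntegrable.

(** * Restrictions of C^1 functions as traces, and sums of traces *)

Section Traces.
Variable R : realType.
Variable Om : set (E3 R).
Hypotheses (oOm : open Om) (bOm : bounded_set Om) (sOm : smooth_bdry Om).
Implicit Types (u v : wfun R) (f w : E3 R -> R) (p q : 'I_3).

Lemma measurable_bdry : measurable (bdry Om : set (surface_space R)).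
Proof. exact/closed_measurable_area/bdry_closed. Qed.

Lemma measurable_dom : measurable (Om : set (E3 (measurableTypeR R))).
Proof. exact: open_measurable_leb. Qed.

Lemma area_bdry_lty : (area R (bdry Om) < +oo)%E.
Proof. exact: area_bdry_fin. Qed.

Lemma bdry_bounded_continuous f : continuous f ->
  exists C : R, forall x, bdry Om x -> `|f x| <= C.
Proof.
move=> cf; have [M M0 OmM] := bounded_set_cube bOm.
have [C C0 fC] := continuous_bounded_cube M cf; exists C => x [cx _].
apply: fC; move: cx; rewrite closureE; apply: smallest_sub => //.
exact: cube_closed.
Qed.

Lemma L2_bdry_continuous f : continuous f -> L2_bdry (bdry Om) f.
Proof.
move=> cf; have [C fC] := bdry_bounded_continuous cf.
apply: (L2_bounded measurable_bdry area_bdry_lty _ fC).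
exact: measurable_funS (continuous_measurable_area cf).
Qed.

(** The constant sequence f approximates itself, and both distances are zero; w has to match f on S
    only. *)
Lemma C1_has_trace f w : C1 f -> (forall x, bdry Om x -> f x = w x) ->
  has_trace Om (classical f) w.
Proof.
move=> Cf fw; split.
  apply: (@eq_L2 _ (surface_space R) _ (area R) _ _ _ fw).
  by apply: L2_bdry_continuous; exact: Cf.1.
exists (fun _ => f); split=> //.
  rewrite (_ : H1_sqdist _ _ _ = 0%E); first exact: cvg_cst.
  apply: integral0_eq => x _; rewrite subrr expr0n /= big1 ?addr0// => p _.
  by rewrite subrr expr0n.
rewrite (_ : L2_bdry_sqdist _ _ _ = 0%E); first exact: cvg_cst.
by apply: integral0_eq => x /fw ->; rewrite subrr expr0n.
Qed.

Lemma C1_H12 f w : C1 f -> (forall x, bdry Om x -> f x = w x) -> H12 Om w.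
Proof.
by move=> Cf fw; exists (classical f); split; [exact: C1_H1|exact: C1_has_trace].
Qed.

Definition addw u v : wfun R := WFun (fun x => wval u x + wval v x)
  (fun p x => wgrad u p x + wgrad v p x).

Lemma H1D u v : H1 Om u -> H1 Om v -> H1 Om (addw u v).
Proof.
move=> [Lu Hu] [Lv Hv]; split; first exact: (L2D measurable_dom).
move=> p; have [Lup Iu] := Hu p; have [Lvp Iv] := Hv p.
split; first exact: (L2D measurable_dom).
move=> f tf; have Cf := smooth_C1 tf.1.
have Lf : L2_dom Om f by apply: L2_dom_continuous => //; exact: Cf.1.
have Ldf : L2_dom Om (pd p f).
  by apply: L2_dom_continuous => // x; exact: C1_continuous_pd.
have E (a b c : E3 R -> R) : L2_dom Om a -> L2_dom Om b -> L2_dom Om c ->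
    int_dom Om (fun x => (a x + b x) * c x) =
    int_dom Om (fun x => a x * c x) + int_dom Om (fun x => b x * c x).
  move=> La Lb Lc; rewrite /int_dom -RintegralD.
  - by congr (Rintegral _ _ _); apply/funext => x; rewrite mulrDl.
  - exact: measurable_dom.
  - exact: (L2_mul_integrable measurable_dom La Lc).
  - exact: (L2_mul_integrable measurable_dom Lb Lc).
by rewrite /= !E// (Iu f tf) (Iv f tf) opprD.
Qed.

Definition sqdiff u v (x : E3 R) : R :=
  (wval u x - wval v x) ^+ 2 + \sum_(p < 3) (wgrad u p x - wgrad v p x) ^+ 2.

Lemma measurable_sqdiff f u : C1 f -> H1 Om u ->
  measurable_fun (Om : set (E3 (measurableTypeR R))) (sqdiff (classical f) u).
Proof.
move=> Cf [[mu _] Hu]; apply: measurable_funD.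
  apply: measurable_funX; apply: measurable_funB => //.
  exact: measurable_funS (continuous_measurable_leb Cf.1).
apply: measurable_sum => p; apply: measurable_funX.
apply: measurable_funB; last by have [[]] := Hu p.
apply: measurable_funS (continuous_measurable_leb _) => //.
exact: C1_continuous_pd.
Qed.

Lemma sqdiff_ge0 u v x : 0 <= sqdiff u v x.
Proof. by rewrite addr_ge0 ?sqr_ge0// sumr_ge0// => p _; exact: sqr_ge0. Qed.

Lemma squeeze_double (a b c : nat -> \bar R) :
  (forall k, 0 <= a k)%E -> (forall k, a k <= 2%:E * b k + 2%:E * c k)%E ->
  b k @[k --> \oo] --> 0%E -> c k @[k --> \oo] --> 0%E ->
  a k @[k --> \oo] --> 0%E.
Proof.
move=> a0 abc b0 c0; apply: (@squeeze_cvge _ _ _ _ (fun _ => 0%E) _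
    (fun k => 2%:E * b k + 2%:E * c k)%E).
- by apply: nearW => k; rewrite a0 abc.
- exact: cvg_cst.
have <- : (2%:E * 0 + 2%:E * 0 = 0 :> \bar R)%E by rewrite !mule0 adde0.
apply: cvgeD; first by rewrite !mule0.
  by apply: cvgeZl.
by apply: cvgeZl.
Qed.

(** The sums of the two approximating sequences approximate the sum, in H^1 and in L^2 of S. This
    makes h0 + chi an admissible competitor in the inequality. *)
Lemma has_traceD u v w w' : H1 Om u -> H1 Om v ->
  has_trace Om u w -> has_trace Om v w' ->
  has_trace Om (addw u v) (fun x => w x + w' x).
Proof.
move=> Hu Hv [Lw [f [Cf fu fw]]] [Lw' [g [Cg gv gw]]]; split.
  exact: (L2D measurable_bdry).
exists (fun k x => f k x + g k x); split.
- by move=> k; exact: C1D.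
- apply: squeeze_double fu gv => k.
    by apply: integral_ge0 => x _; rewrite lee_fin sqdiff_ge0.
  have Cfg := C1D (Cf k) (Cg k).
  apply: (le_integral_double _ measurable_dom
     (s := sqdiff (classical (fun x => f k x + g k x)) (addw u v))
     (s1 := sqdiff (classical (f k)) u) (s2 := sqdiff (classical (g k)) v)).
  + by apply: measurable_sqdiff => //; exact: H1D.
  + exact: measurable_sqdiff.
  + exact: measurable_sqdiff.
  + by move=> x; exact: sqdiff_ge0.
  + by move=> x; exact: sqdiff_ge0.
  + by move=> x; exact: sqdiff_ge0.
  move=> x _; rewrite /sqdiff /= !sum_I3.
  have [_ pdE] := C1D_pd (Cf k) (Cg k); rewrite !pdE.
  have sq2 (a b c e : R) : (a + b - (c + e)) ^+ 2 <= 2 * (a - c) ^+ 2 + 2 * (b - e) ^+ 2.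
    by have := sqr_ge0 ((a - c) - (b - e)); clear; nra.
  have sum4 (s0 s1 s2 s3 a0 a1 a2 a3 b0 b1 b2 b3 : R) :
      s0 <= 2 * a0 + 2 * b0 -> s1 <= 2 * a1 + 2 * b1 ->
      s2 <= 2 * a2 + 2 * b2 -> s3 <= 2 * a3 + 2 * b3 ->
      s0 + (s1 + s2 + s3) <= 2 * (a0 + (a1 + a2 + a3)) + 2 * (b0 + (b1 + b2 + b3)).
    by clear; lra.
  by apply: sum4; exact: sq2.
- apply: squeeze_double fw gw => k.
    by apply: integral_ge0 => x _; rewrite lee_fin sqr_ge0.
  have mc (F : E3 R -> R) : C1 F -> measurable_fun (bdry Om : set (surface_space R)) F.
    by move=> CF; apply: measurable_funS (continuous_measurable_area CF.1).
  have mB (F G : E3 R -> R) : C1 F -> L2_bdry (bdry Om) G -> measurable_fun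
      (bdry Om : set (surface_space R)) (fun x => (F x - G x) ^+ 2).
    by move=> CF [mG _]; apply: measurable_funX; apply: measurable_funB => //; exact: mc.
  apply: (le_integral_double _ measurable_bdry
    (s := fun x => (f k x + g k x - (w x + w' x)) ^+ 2)
    (s1 := fun x => (f k x - w x) ^+ 2) (s2 := fun x => (g k x - w' x) ^+ 2)).
  + apply: mB; first exact: C1D.
    exact: (L2D measurable_bdry).
  + exact: mB.
  + exact: mB.
  + by move=> x; exact: sqr_ge0.
  + by move=> x; exact: sqr_ge0.
  + by move=> x; exact: sqr_ge0.
  have sq2 (a b c e : R) : (a + b - (c + e)) ^+ 2 <= 2 * (a - c) ^+ 2 + 2 * (b - e) ^+ 2.
    by have := sqr_ge0 ((a - c) - (b - e)); clear; nra.
  by move=> x _; exact: sq2.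
Qed.

Lemma H12D w w' : H12 Om w -> H12 Om w' -> H12 Om (fun x => w x + w' x).
Proof.
move=> [u [Hu tu]] [v [Hv tv]]; exists (addw u v).
by split; [exact: H1D|exact: has_traceD].
Qed.

End Traces.

(** * Rigid displacements and the friction functional *)

Section Rigid.
Variable R : realType.
Implicit Types (a b : 'I_3 -> R) (p q : 'I_3) (x : E3 R).

(** Grouping by the coordinates of x exhibits the rotation as a linear form, from which the constant
    partial derivatives are read off. *)
Lemma rigid1E a b q : (rigid a b).1 q = fun x =>
  (\sum_(k < 3) levi R q k 0 * a k) * coord x 0 +
  (\sum_(k < 3) levi R q k 1 * a k) * coord x 1 +
  (\sum_(k < 3) levi R q k 2%:R * a k) * coord x 2%:R + b q.
Proof.
apply/funext => x; rewrite /rigid /cross /= exchange_big sum_I3 /=.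
by congr (_ + _ + _ + _); rewrite mulr_suml.
Qed.

Lemma rigid1_C1_pd a b q : C1 ((rigid a b).1 q) /\
  forall p, pd p ((rigid a b).1 q) = fun=> \sum_(k < 3) levi R q k p * a k.
Proof.
have lin (c : R) r : C1 (fun x => c * coord x r) /\
    forall p, pd p (fun x => c * coord x r) = fun _ => c * kron R p r.
  have [Cc Pc] := C1_coord_pd R r; have [CM PM] := C1M_pd (C1_cst c) Cc.
  split=> // p; rewrite PM Pc; apply/funext => x.
  by rewrite /pd derive_cst mulr0 addr0.
rewrite rigid1E.
have [C0 P0] := lin (\sum_(k < 3) levi R q k 0 * a k) 0.
have [C1' P1] := lin (\sum_(k < 3) levi R q k 1 * a k) 1.
have [C2 P2] := lin (\sum_(k < 3) levi R q k 2%:R * a k) 2%:R.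
have [C01 P01] := C1D_pd C0 C1'; have [C012 P012] := C1D_pd C01 C2.
have [Call Pall] := C1D_pd C012 (C1_cst (b q)).
split=> // p; rewrite Pall P012 P01 P0 P1 P2; apply/funext => x.
rewrite /pd derive_cst addr0.
by move: p; apply: forall_I3; rewrite /kron /= !mulr0 ?mulr1 ?addr0 ?add0r.
Qed.

Lemma rigid1_C1 a b q : C1 ((rigid a b).1 q).
Proof. by have [] := rigid1_C1_pd a b q. Qed.

(** Every term of the energy carries a strain or a microrotation gradient of its second argument.
    The latter is zero because a is constant; in the former, d_p of (a x x)_q cancels the sum of
    levi p q k a_k. *)
Lemma energy_rigid m (U : wfield6 R) a b x :
  energy m U (classical6 (rigid a b)) x = 0.
Proof.
rewrite /energy big1// => p _; rewrite big1// => q _.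
have -> : wgrad ((classical6 (rigid a b)).2 q) p x = 0.
  by rewrite /= /pd derive_cst.
have -> : strain (classical6 (rigid a b)) p q x = 0.
  rewrite /strain /= (rigid1_C1_pd a b q).2 -sumrB big1// => k _.
  (* Cyclic symmetry, levi q k p = levi p q k, checked on all index triples. *)
  by rewrite -mulrBl /levi (_ : _ - _ = 0) ?mul0r//;
    move: p q k; apply: forall_I3; apply: forall_I3; apply: forall_I3;
    rewrite /= ?subrr.
by rewrite !mulr0 addr0.
Qed.

Lemma rigid_opp1 a b q : (rigid (fun p => - a p) (fun p => - b p)).1 q =
  fun x => - (rigid a b).1 q x.
Proof.
apply/funext => x; rewrite /rigid /cross /= opprD -sumrN; congr (_ + _).
apply: eq_bigr => k _; rewrite -sumrN; apply: eq_bigr => l _.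
by rewrite mulrN mulNr.
Qed.

End Rigid.

Section BoundaryIntegrals.
Variable R : realType.
Variable Om : set (E3 R).
Variable n : vfield R.
Hypotheses (oOm : open Om) (bOm : bounded_set Om) (sOm : smooth_bdry Om).
Hypothesis nOm : outward_unit_normal Om n.
Implicit Types (f g w : E3 R -> R) (F H : vfield R).
Local Notation S := (bdry Om : set (surface_space R)).
Let mS : measurable S := measurable_bdry Om.

Lemma norm3D (a b : 'I_3 -> R) : norm3 (fun p => a p + b p) <= norm3 a + norm3 b.
Proof.
rewrite -(@ler_pXn2r _ 2)// ?nnegrE ?addr_ge0 ?norm3_ge0//.
rewrite sqrrD !sqr_norm3.
have CS : dot a b <= norm3 a * norm3 b.
  apply: le_trans (ler_norm _) _.
  rewrite -(@ler_pXn2r _ 2)// ?nnegrE ?mulr_ge0 ?norm3_ge0//.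
  rewrite exprMn !sqr_norm3 real_normK ?num_real// /dot !sum_I3.
  (* Lagrange's identity: the three squares add up to |a|^2 |b|^2 - (a . b)^2. *)
  have := sqr_ge0 (a 0 * b 1 - a 1 * b 0); have := sqr_ge0 (a 0 * b 2%:R - a 2%:R * b 0).
  by have := sqr_ge0 (a 1 * b 2%:R - a 2%:R * b 1); nra.
move: CS; rewrite /dot !sum_I3; lra.
Qed.

(** n is given pointwise through local defining functions; on S it coincides with the continuous
    field N, whence its measurability. *)
Lemma normal_measurable q : measurable_fun S (n q).
Proof.
have [N [CN NE]] := normal_C1_extension bOm sOm nOm.
apply: (@eq_measurable_fun _ _ _ _ S (N q)).
  by move=> x; rewrite inE => /NE.
exact: measurable_funS (continuous_measurable_area (CN q).1).
Qed.

Lemma normal_le1 q x : bdry Om x -> `|n q x| <= 1.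
Proof.
move=> Bx; have := outward_unit_normal_norm sOm nOm Bx.
rewrite -sqr_norm3 => /eqP; rewrite sqrf_eq1 => /orP[/eqP E|/eqP E].
  by rewrite -E; exact: (ler_norm3 (n ^~ x)).
by have := norm3_ge0 (n ^~ x); rewrite E; lra.
Qed.

Lemma L2_bdry_mul_bounded f g (C : R) : L2_bdry (bdry Om) f ->
  measurable_fun S g -> (forall x, bdry Om x -> `|g x| <= C) ->
  L2_bdry (bdry Om) (fun x => f x * g x).
Proof. exact: (L2_mul_bounded mS). Qed.

Lemma L2_bdryD f g : L2_bdry (bdry Om) f -> L2_bdry (bdry Om) g ->
  L2_bdry (bdry Om) (fun x => f x + g x).
Proof. exact: (L2D mS). Qed.

Lemma L2_bdry_abs f : L2_bdry (bdry Om) f -> L2_bdry (bdry Om) (fun x => `|f x|).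
Proof. exact: L2_abs. Qed.

Lemma L2_bdryZ (c : R) f : L2_bdry (bdry Om) f -> L2_bdry (bdry Om) (fun x => c * f x).
Proof. exact: (L2Z mS). Qed.

Lemma L2_bdry_nrm F : (forall q, L2_bdry (bdry Om) (F q)) ->
  L2_bdry (bdry Om) (nrm n F).
Proof.
move=> LF; have L q : L2_bdry (bdry Om) (fun x => F q x * n q x).
  apply: (L2_bdry_mul_bounded (C := 1) (LF q) (normal_measurable q)).
  exact: normal_le1.
rewrite (_ : nrm n F = fun x => F 0 x * n 0 x + F 1 x * n 1 x + F 2%:R x * n 2%:R x).
  by apply: L2_bdryD (L _); exact: L2_bdryD.
by apply/funext => x; exact: sum_I3.
Qed.

Lemma L2_bdry_tang F q : (forall q, L2_bdry (bdry Om) (F q)) ->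
  L2_bdry (bdry Om) (tang n F q).
Proof.
move=> LF; rewrite (_ : tang n F q = fun x => F q x + -1 * (nrm n F x * n q x)).
  apply: L2_bdryD (LF q) _; apply: L2_bdryZ.
  apply: (L2_bdry_mul_bounded (C := 1) (L2_bdry_nrm LF) (normal_measurable q)).
  exact: normal_le1.
by apply/funext => x; rewrite mulN1r.
Qed.

Lemma L2_bdry_length F : (forall q, L2_bdry (bdry Om) (F q)) ->
  L2_bdry (bdry Om) (length F).
Proof. exact: (L2_norm3 mS). Qed.

Lemma Linf_L2 f : Linf_bdry (bdry Om) f -> L2_bdry (bdry Om) f.
Proof.
move=> [mf [C fC]].
exact: (L2_ae_bounded mS (area_bdry_lty oOm bOm sOm) mf fC).
Qed.

End BoundaryIntegrals.

(** * Subadditivity of the friction functional and oddness of psi *)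

Section Friction.
Variable R : realType.
Variable Om : set (E3 R).
Variable n : vfield R.
Hypotheses (oOm : open Om) (bOm : bounded_set Om) (sOm : smooth_bdry Om).
Hypothesis nOm : outward_unit_normal Om n.
Implicit Types (f g w : E3 R -> R) (F H : vfield R).
Local Notation S := (bdry Om : set (surface_space R)).
Let mS : measurable S := measurable_bdry Om.

Lemma nrmD F H x : nrm n (fun q y => F q y + H q y) x = nrm n F x + nrm n H x.
Proof. by rewrite -big_split; apply: eq_bigr => q _; rewrite mulrDl. Qed.

Lemma tangD F H q x :
  tang n (fun r y => F r y + H r y) q x = tang n F q x + tang n H q x.
Proof. by rewrite /tang nrmD mulrDl opprD addrACA. Qed.

Lemma nrmN F x : nrm n (fun q y => - F q y) x = - nrm n F x.
Proof. by rewrite -sumrN; apply: eq_bigr => q _; rewrite mulNr. Qed.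

Lemma length_tangN F x : length (tang n (fun q y => - F q y)) x = length (tang n F) x.
Proof.
congr Num.sqrt; apply: eq_bigr => q _.
by rewrite /tang nrmN mulNr -opprD mulrNN.
Qed.

(** Tangential parts are additive, so phi0 can stay with h and the triangle inequality splits off
    chi_s. The L^2 assumptions make all three integrands integrable. *)
Lemma friction_functionalD g (phi0 h chi : vfield R) :
  (forall x, bdry Om x -> 0 <= g x) -> L2_bdry (bdry Om) g ->
  (forall q, L2_bdry (bdry Om) (phi0 q)) ->
  (forall q, L2_bdry (bdry Om) (h q)) ->
  (forall q, L2_bdry (bdry Om) (chi q)) ->
  friction_functional Om n g phi0 (fun q x => h q x + chi q x) <=
  friction_functional Om n g phi0 h +
  int_bdry (bdry Om) (fun x => g x * length (tang n chi) x).
Proof.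
move=> g0 Lg Lphi Lh Lchi.
have Lsub F q : (forall q, L2_bdry (bdry Om) (F q)) ->
    L2_bdry (bdry Om) (fun x => tang n F q x - phi0 q x).
  move=> LF; rewrite (_ : (fun _ => _) = fun x => tang n F q x + -1 * phi0 q x).
    apply: L2_bdryD; first exact: L2_bdry_tang.
    exact: L2_bdryZ.
  by apply/funext => x; rewrite mulN1r.
have int_len F : (forall q, L2_bdry (bdry Om) (F q)) ->
    (area R).-integrable S (EFin \o (fun x => g x * length F x)).
  by move=> LF; apply: (L2_mul_integrable mS Lg); exact: L2_bdry_length.
have i1 := int_len (fun q y => tang n h q y - phi0 q y) (fun q => Lsub h q Lh).
have i2 := int_len (tang n chi) (fun q => L2_bdry_tang bOm sOm nOm q Lchi).
rewrite /friction_functional /int_bdry -RintegralD //.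
apply: le_Rintegral => //.
- by apply: int_len => q; apply: Lsub => r; exact: L2_bdryD.
- exact: (integrableD mS i1 i2).
move=> x Bx; rewrite -mulrDr ler_wpM2l ?g0//.
apply: le_trans (norm3D _ _); rewrite /length le_eqVlt; apply/orP; left.
by apply/eqP; congr norm3; apply/funext => q; rewrite tangD addrAC.
Qed.

Lemma Hm12N t w : Hm12 Om t -> H12 Om w -> t (fun x => - w x) = - t w.
Proof.
move=> [lin _] Hw.
(* Linearity is given for c w1 + w2 with both terms in H^{1/2}: first c = 1 with zero functions
   gives t 0 = 0, then c = -1 with w2 = 0 gives the claim. *)
have H0 : H12 Om (fun _ => 0) by apply: (C1_H12 oOm bOm sOm (C1_cst 0)).
have t0 : t (fun _ => 0) = 0.
  have := lin 1 _ _ H0 H0; under eq_fun do rewrite mulr0 addr0.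
  by rewrite mul1r => /eqP; rewrite -[X in X == _]addr0 (inj_eq (addrI _)) eq_sym => /eqP.
have := lin (-1) _ _ Hw H0; under eq_fun do rewrite mulN1r addr0.
by rewrite t0 addr0 mulN1r.
Qed.

Lemma C1_normal_mul_H12 F q : (forall q, C1 (F q)) ->
  H12 Om (fun x => n q x * nrm n F x).
Proof.
move=> CF; have [N [CN NE]] := normal_C1_extension bOm sOm nOm.
apply: (C1_H12 oOm bOm sOm (f := fun x => N q x *
  \sum_(r <- enum 'I_3) F r x * N r x)).
  by apply: C1M => //; apply: C1_sum => r _; exact: C1M.
move=> x Bx; rewrite NE// big_enum /=; congr (_ * _).
by apply: eq_bigr => r _; rewrite NE.
Qed.

(** The integral part is odd because F0 and the normal part of F are in L^2 of S; the trace part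
    because each component of the functional is evaluated at n_q times the normal part, which is in
    H^{1/2}. *)
Lemma psi_dataN (F0 : E3 R -> R) (t0 : functional6 R) F :
  Linf_bdry (bdry Om) F0 -> Hm12_3 Om t0.1 ->
  (forall q, C1 (F q)) ->
  psi_data Om n F0 t0 (nrm n (fun q x => - F q x)) =
  - psi_data Om n F0 t0 (nrm n F).
Proof.
move=> LF0 Ht CF; rewrite /psi_data.
have -> : nrm n (fun q x => - F q x) = fun x => - nrm n F x.
  by apply/funext => x; exact: nrmN.
rewrite opprB addrC; congr (_ + _); last first.
  rewrite /int_bdry -mulN1r -RintegralZl//.
    by congr (Rintegral _ _ _); apply/funext => x; rewrite mulN1r mulrN.
  apply: (L2_mul_integrable mS); first exact: Linf_L2.
  by apply: L2_bdry_nrm => // q; apply: L2_bdry_continuous => //; exact: (CF q).1.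
rewrite /nrm_fun -sumrN; apply: eq_bigr => q _.
under eq_fun do rewrite mulrN.
by rewrite Hm12N ?opprK//; exact: C1_normal_mul_H12.
Qed.

End Friction.

Theorem mainTheorem6 (R : realType) (Om : set (E3 R)) (n : vfield R)
    (m : material R)
    (X : vfield6 R) (F0 : E3 R -> R) (phi : functional3 R) (Fr : E3 R -> R)
    (U0 : wfield6 R) (w0 : vfield R) (t0 : functional6 R)
    (G : vfield6 R -> wfield6 R) (A : vfield6 R -> functional6 R) :
  bounded_domain Om ->
  smooth_bdry Om ->
  simply_connected (bdry Om) ->
  ~ surface_of_revolution (bdry Om) ->
  ~ ruled_surface (bdry Om) ->
  outward_unit_normal Om n ->
  admissible m ->
  L2_6 Om X ->
  Linf_bdry (bdry Om) F0 ->
  Hm12_3 Om phi ->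
  bounded_measurable_bdry (bdry Om) Fr ->
  (forall x, bdry Om x -> 0 <= Fr x) ->
  auxiliary_solution m Om n X U0 w0 t0 ->
  dirichlet_operator m Om G ->
  steklov_poincare m Om G A ->
  let g := fun x => Fr x * `|F0 x| in
  let psi := psi_data Om n F0 t0 in
  let phi0 := phi0_data n w0 in
  let j := friction_functional Om n g phi0 in
  (exists h0 : vfield6 R, H12_6 Om h0 /\
     forall h : vfield6 R, H12_6 Om h ->
       pair6 (A h0) (sub6 h h0) + j h.1 - j h0.1 >=
       psi (fun x => nrm n h.1 x - nrm n h0.1 x) + pair3 phi (sub6 h h0).2) ->
  forall a b : 'I_3 -> R,
    `| psi (nrm n (rigid a b).1) + pair3 phi (rigid a b).2 | <=
    int_bdry (bdry Om) (fun x => g x * length (tang n (rigid a b).1) x).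

Proof.
move=> [oOm _ _ bOm] sOm _ _ _ nOm _ _ LF0 Hphi [mFr [C FrC]] Fr0.
move=> [_ tw0 [_ _ Ht0 _] _ _] _ HA g psi phi0 j [h0 [Hh0 VI]].
have Cchi (a b : 'I_3 -> R) q : C1 ((rigid a b).1 q) := rigid1_C1 a b q.
have Hchi (a b : 'I_3 -> R) : H12_6 Om (rigid a b).
  move=> q; split; first by apply: (C1_H12 oOm bOm sOm (Cchi a b q)).
  by apply: (C1_H12 oOm bOm sOm (C1_cst (a q))).
have g0 x : bdry Om x -> 0 <= g x by move=> Bx; rewrite mulr_ge0 ?Fr0.
have Lg : L2_bdry (bdry Om) g.
  rewrite (_ : g = fun x => `|F0 x| * Fr x).
    have LabsF0 := L2_bdry_abs (Linf_L2 oOm bOm sOm LF0).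
    exact: L2_bdry_mul_bounded LabsF0 mFr FrC.
  by apply/funext => x; rewrite mulrC.
have Lphi0 q : L2_bdry (bdry Om) (phi0 q).
  rewrite (_ : phi0 q = fun x => -1 * tang n w0 q x).
    by apply: L2_bdryZ; apply: L2_bdry_tang => // r; have [] := tw0 r.
  by apply/funext => x; rewrite mulN1r.
(* Square integrability on S is part of [has_trace], so it comes with membership in H^{1/2}. *)
have Lh0 q : L2_bdry (bdry Om) (h0.1 q).
  by have [[u [_ []]]] := (Hh0 q).
have key (a b : 'I_3 -> R) : psi (nrm n (rigid a b).1) + pair3 phi (rigid a b).2 <=
    int_bdry (bdry Om) (fun x => g x * length (tang n (rigid a b).1) x).
  pose h : vfield6 R := (fun q x => h0.1 q x + (rigid a b).1 q x,
                         fun q x => h0.2 q x + (rigid a b).2 q x).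
  have Hh : H12_6 Om h.
    by move=> q; split; apply: H12D => //;
      [exact: (Hh0 q).1|exact: (Hchi a b q).1|exact: (Hh0 q).2|exact: (Hchi a b q).2].
  have hE : sub6 h h0 = rigid a b.
    by rewrite /sub6 /h /=; congr pair; apply/funext => q; apply/funext => x;
      rewrite addrAC subrr add0r.
  have := VI h Hh; rewrite hE.
  (* [psi] takes the difference of normal parts as a single function, which is chi_n at every
     point. *)
  have -> : (fun x => nrm n h.1 x - nrm n h0.1 x) = nrm n (rigid a b).1.
    by apply/funext => x; rewrite nrmD addrAC subrr add0r.
  have -> : pair6 (A h0) (rigid a b) = 0.
    (* The volume force of [G h0] is zero, so Green's formula with chi as second argument leaves the
       energy term alone. *)
    have [_ _ _ green] := HA h0 Hh0.
    rewrite -(green (classical6 (rigid a b))).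
    + rewrite /int_dom /Rintegral integral0_eq// => x _.
      rewrite energy_rigid addr0 /dot6 big1// => q _.
      by rewrite !mul0r addr0.
    + by move=> q; split; [exact: C1_H1|exact: (C1_H1 oOm bOm (C1_cst (a q)))].
    + move=> q; split; first exact: C1_has_trace.
      by apply: (C1_has_trace oOm bOm sOm (C1_cst (a q))).
  rewrite add0r => /le_trans; apply; rewrite lerBlDl.
  apply: friction_functionalD => // q.
  by apply: L2_bdry_continuous => //; exact: (Cchi a b q).1.
move=> a b; rewrite ler_norml key andbT lerNl.
have := key (fun q => - a q) (fun q => - b q).
have -> : (rigid (fun q => - a q) (fun q => - b q)).1 = fun q x => - (rigid a b).1 q x.
  by apply/funext => q; exact: rigid_opp1.
(* The bound is even in chi, while both terms on the left are odd. *)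
under [in X in _ <= X -> _]eq_fun do rewrite length_tangN.
have -> : pair3 phi (rigid (fun q => - a q) (fun q => - b q)).2 =
    - pair3 phi (rigid a b).2.
  rewrite /pair3 -sumrN; apply: eq_bigr => q _.
  by apply: (Hm12N oOm bOm sOm (Hphi q)); exact: (Hchi a b q).2.
by rewrite /psi psi_dataN -?opprD//; have [] := Ht0.
Qed.
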